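(* Let $M$ be a smooth compact surface without boundary embedded in $\mathbb{R}^3$ with positive reach $\rho=\rho(M)$. Let $P$ be an $\varepsilon$-sample of $(M,d_E)$, and let $Q\subseteq P$ be a $\delta$-sparse $\delta$-sample of $(P,d_E)$. If $12\varepsilon\le\alpha\le\frac{2}{27}\rho$ and $8\varepsilon\le\delta\le\frac{2}{27}\rho$, then the map $$h_*:\mathsf{H}_1(\mathcal{R}^{\alpha}(P))\to \mathsf{H}_1(\mathcal{G}^{\alpha}(P,Q,d_E))$$ is an isomorphism, where $h:\mathcal{R}^{\alpha}(P)\to\mathcal{G}^{\alpha}(P,Q,d_E)$ is the simplicial map induced by the nearest point map $\nu_{d_E}:P\to Q$.
   Context: $d_E$ is the Euclidean distance. The reach $\rho(M)$ is the minimum distance from $M$ to its medial axis. A finite set $P\subseteq X$ is an $\varepsilon$-sample of a metric space $(X,d)$ if every $x\in X$ has a point $p\in P$ with $d(x,p)\le\varepsilon$; it is $\delta$-sparse if $d(p_1,p_2)\ge\delta$ for all distinct $p_1,p_2\in P$. For a finite $P\subset\mathbb{R}^n$, the (Vietoris-)Rips complex $\mathcal{R}^{\alpha}(P)$ is the simplicial complex whose simplices are the nonempty subsets of $P$ with all pairwise Euclidean distances at most $\alpha$. $G^{\alpha}(P)$ is the graph on $P$ joining $p_1,p_2$ iff $\|p_1-p_2\|\le\alpha$. Given a distance $d$ on $P$ and $Q\subseteq P$, the nearest point map $\nu_d:P\to Q$ sends each $p$ to a point of $Q$ minimizing $d(p,\cdot)$ over $Q$. The graph induced complex $\mathcal{G}^{\alpha}(P,Q,d)$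 is the simplicial complex with vertex set $Q$ in which a set $\{q_1,\dots,q_{k+1}\}$ of $k+1$ distinct points of $Q$ is a $k$-simplex iff there is a $(k+1)$-clique $\{p_1,\dots,p_{k+1}\}$ in $G^{\alpha}(P)$ with $\nu_d(p_i)=q_i$ for all $i$. The map $h$ sends a simplex $\{p_1,\dots,p_{k+1}\}$ of $\mathcal{R}^{\alpha}(P)$ to the simplex with vertex set $\{\nu_d(p_1),\dots,\nu_d(p_{k+1})\}$. Homology is simplicial homology with coefficients in $\mathbb{Z}_2$. *)

(* Defs.v *)
From HB Require Import structures.
From mathcomp Require Import all_boot all_order all_algebra finmap.

Set Implicit Arguments.
Unset Strict Implicit.
Unset Printing Implicit Defensive.

Import Order.TTheory GRing.Theory Num.Theory.

Local Open Scope ring_scope.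

Section QuotientSpace.
Local Open Scope quotient_scope.
Variables (F : fieldType) (vT : vectType F) (U : {vspace vT}).

(* U is a subgroup of vT, hence an ideal in the sense of ring_quotient; the   *)
(* scaling is added below.                                                   *)
Definition vquot := {ideal_quot (U : zmodClosed vT)}.

HB.instance Definition _ := GRing.Zmodule.on vquot.

Definition vproj : vT -> vquot := \pi_({ideal_quot (U : zmodClosed vT)}).
Definition vrepr : vquot -> vT := repr.

Lemma vreprK x : vproj (vrepr x) = x.
Proof. exact: reprK. Qed.

Lemma vproj_eq x y : (vproj x == vproj y) = (x - y \in U).
Proof. exact/esym/(Quotient.idealrBE (U : zmodClosed vT)). Qed.

Lemma vprojD x y : vproj (x + y) = vproj x + vproj y.
Proof. exact: Quotient.pi_add. Qed.

Lemma vreprP x : x - vrepr (vproj x) \in U.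
Proof. by rewrite -vproj_eq vreprK. Qed.

Definition vquot_scale (a : F) (x : vquot) : vquot := vproj (a *: vrepr x).

Lemma vquot_scaleE a x : vquot_scale a (vproj x) = vproj (a *: x).
Proof.
apply/eqP; rewrite vproj_eq -scalerBr memvZ // -memvN opprB; exact: vreprP.
Qed.

Fact vquot_scaleA a b x :
  vquot_scale a (vquot_scale b x) = vquot_scale (a * b) x.
Proof. by rewrite -[x]vreprK !vquot_scaleE scalerA. Qed.

Fact vquot_scale1 : left_id 1 vquot_scale.
Proof. by move=> x; rewrite -[x]vreprK vquot_scaleE scale1r. Qed.

Fact vquot_scaleDr : right_distributive vquot_scale +%R.
Proof.
move=> a x y; rewrite -[x]vreprK -[y]vreprK -vprojD !vquot_scaleE.
by rewrite scalerDr vprojD.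
Qed.

Fact vquot_scaleDl x : {morph vquot_scale^~ x : a b / a + b}.
Proof.
move=> a b /=; rewrite -[x]vreprK !vquot_scaleE.
by rewrite scalerDl vprojD.
Qed.

HB.instance Definition _ := GRing.Zmodule_isLmodule.Build F vquot
  vquot_scaleA vquot_scale1 vquot_scaleDr vquot_scaleDl.

Fact vproj_linear : linear vproj.
Proof. by move=> a x y; rewrite vprojD -vquot_scaleE. Qed.

HB.instance Definition _ :=
  GRing.isLinear.Build F vT vquot *:%R vproj vproj_linear.

End QuotientSpace.

Record simplicial_complex (V : finType) := SimplicialComplex {
  simplices :> {set {set V}};
  simplex_neq0 : forall s, s \in simplices -> s != set0;
  simplex_sub : forall s t : {set V},
    s \in simplices -> t \subset s -> t != set0 -> t \in simplices
}.

Record simplicial_map (V W : finType) (K : simplicial_complex V) (L : simplicial_complex W) :=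
  SimplicialMap {
    vertex_map :> V -> W;
    simplicial_mapP : forall s, s \in K -> vertex_map @: s \in L
  }.

Definition ksimplex (V : finType) (K : simplicial_complex V) (k : nat) :=
  {s : {set V} | (s \in K) && (#|s| == k.+1)}.
HB.instance Definition _ V K k := Finite.on (@ksimplex V K k).

Definition chain (V : finType) (K : simplicial_complex V) (k : nat) :=
  {ffun ksimplex K k -> ('F_2)^o}.
HB.instance Definition _ V K k := Vector.on (@chain V K k).

Definition boundary (V : finType) (K : simplicial_complex V) (k : nat)
    (c : chain K k.+1) : chain K k :=
  [ffun t : ksimplex K k => \sum_(s : ksimplex K k.+1 | val t \subset val s) c s].

(* A k-simplex collapsed by f is equal to no k-simplex of L, so that it is *)
(* sent to 0.                                                              *)
Definition chain_map (V W : finType) (K : simplicial_complex V) (L : simplicial_complex W)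
    (f : simplicial_map K L) (k : nat) (c : chain K k) : chain L k :=
  [ffun t : ksimplex L k => \sum_(s : ksimplex K k | f @: val s == val t) c s].

Fact boundary_linear V K k : linear (@boundary V K k).
Proof.
move=> a c d; apply/ffunP => t; rewrite !ffunE scaler_sumr -big_split.
by apply: eq_bigr => s _; rewrite !ffunE.
Qed.
HB.instance Definition _ V K k :=
  GRing.isLinear.Build _ _ _ _ (@boundary V K k) (@boundary_linear V K k).

Fact chain_map_linear V W K L f k : linear (@chain_map V W K L f k).
Proof.
move=> a c d; apply/ffunP => t; rewrite !ffunE scaler_sumr -big_split.
by apply: eq_bigr => s _; rewrite !ffunE.
Qed.
HB.instance Definition _ V W K L f k := GRing.isLinear.Build _ _ _ _
  (@chain_map V W K L f k) (@chain_map_linear V W K L f k).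

Section BoundaryParity.
Variable V : finType.

Lemma card_sig_pred (P A : pred {set V}) :
  #|[pred s : {s | P s} | A (val s)]| = #|[pred s | P s && A s]|.
Proof.
rewrite -(card_image val_inj); apply: eq_card => s; apply/imageP/idP.
  by case=> -[t Pt] /= At ->; rewrite !inE Pt.
by rewrite !inE => /andP[Ps As]; exists (exist _ s Ps).
Qed.

Lemma card_facets (K : simplicial_complex V) k (s : {set V}) (A : pred {set V}) :
  s \in K -> #|s| = k.+2 ->
  #|[pred r : ksimplex K k | A (val r) && (val r \subset s)]| =
  #|[set x in s | A (s :\ x)]|.
Proof.
move=> sK sk; rewrite (card_sig_pred _ (fun r => A r && (r \subset s))).
rewrite -(card_in_imset (f := fun x => s :\ x)); last first.
  move=> x y; rewrite !inE => /andP[xs _] /andP[ys _] /setP/(_ x).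
  by rewrite !inE eqxx xs andbT; case: eqP.
apply: eq_card => r; rewrite !inE; apply/idP/imsetP.
  case/and3P=> /andP[rK /eqP rk] Ar rs.
  have : #|s :\: r| == 1 by rewrite cardsD (setIidPr rs) sk rk subSnn.
  case/cards1P=> x sr; have : x \in s :\: r by rewrite sr set11.
  rewrite inE => /andP[xr xs].
  have rE : r = s :\ x.
    by rewrite -sr setDDr setDv set0U; apply/esym/setIidPr.
  by exists x; rewrite // inE xs -rE.
case=> x; rewrite inE => /andP[xs As] ->; rewrite As subsetDl andbT.
have sxk : #|s :\ x| = k.+1 by move: sk; rewrite (cardsD1 x) xs => -[].
rewrite sxk eqxx !andbT; apply: simplex_sub sK _ _; first exact: subsetDl.
by rewrite -card_gt0 sxk.
Qed.

Lemma odd_facets (W : finType) (f : V -> W) (s : {set V}) (u : {set W}) k :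
  #|s| = k.+2 -> #|u| = k.+1 ->
  odd #|[set x in s | f @: (s :\ x) == u]| =
  (#|f @: s| == k.+2) && (u \subset f @: s).
Proof.
move=> sk uk.
have skx x : x \in s -> #|s :\ x| = k.+1.
  by move: sk => + xs; rewrite (cardsD1 x) xs => -[].
have [fk|fk] /= := boolP (#|f @: s| == k.+2).
  have /imset_injP finj : #|f @: s| == #|s| by rewrite sk.
  have [us|us] /= := boolP (u \subset f @: s).
    have : #|f @: s :\: u| == 1.
      by rewrite cardsD (setIidPr us) (eqP fk) uk subSnn.
    case/cards1P=> y fsu; have : y \in f @: s :\: u by rewrite fsu set11.
    rewrite inE => /andP[yu /imsetP[x xs yE]].
    suff -> : [set x in s | f @: (s :\ x) == u] = [set x] by rewrite cards1.
    apply/setP => z; rewrite !inE; apply/idP/eqP => [/andP[zs /eqP fzu]|->].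
      apply: finj => //; rewrite -yE; apply/eqP; apply: contraNT yu => zy.
      rewrite -fzu yE imset_f // !inE xs andbT.
      by apply: contraNneq zy => <-; rewrite -yE.
    rewrite xs /= eq_sym eqEcard uk -(skx x xs) leq_imset_card andbT.
    apply/subsetP => w wu; have /imsetP[v vs wE] := subsetP us _ wu.
    rewrite wE imset_f // !inE vs andbT; apply: contraNneq yu => vx.
    by rewrite yE -vx -wE.
  suff -> : [set x in s | f @: (s :\ x) == u] = set0 by rewrite cards0.
  apply/setP => x; rewrite !inE; apply: contraNF us => /andP[_ /eqP <-].
  exact/imsetS/subsetDl.
have : ~~ injectiveb (fun x : {x | x \in s} => f (val x)).
  apply: contra fk => /injectiveP finj; rewrite -sk card_in_imset // => x y xs ys.
  move=> fxy; exact: (congr1 val (finj (exist _ x xs) (exist _ y ys) fxy)).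
case/injectivePn => -[x1 x1s] [[x2 x2s] x12 f12].
have {}x12 : x1 != x2 by [].
rewrite /= in f12.
have f1 : f @: (s :\ x1) = f @: s.
  apply/eqP; rewrite eqEsubset imsetS ?subsetDl //=.
  apply/subsetP => _ /imsetP[x xs ->]; case: (eqVneq x x1) => [->|xx1].
    by rewrite f12 imset_f // !inE x2s eq_sym x12.
  by rewrite imset_f // !inE xx1.
have f2 : f @: (s :\ x2) = f @: s.
  apply/eqP; rewrite eqEsubset imsetS ?subsetDl //=.
  apply/subsetP => _ /imsetP[x xs ->]; case: (eqVneq x x2) => [->|xx2].
    by rewrite -f12 imset_f // !inE x1s x12.
  by rewrite imset_f // !inE xx2.
have only x : x \in s -> f @: (s :\ x) = u -> (x == x1) || (x == x2).
  move=> xs fxu; apply: contraT; rewrite negb_or => /andP[xx1 xx2].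
  have /imset_injP finj : #|f @: (s :\ x)| == #|s :\ x|.
    by rewrite fxu uk skx.
  move: x12; rewrite (finj x1 x2) ?eqxx // !inE ?x1s ?x2s andbT eq_sym //.
have [fsu|fsu] := eqVneq (f @: s) u.
  suff -> : [set x in s | f @: (s :\ x) == u] = [set x1; x2].
    by rewrite cards2 x12.
  apply/setP => x; rewrite !inE; apply/idP/idP.
    by case/andP=> xs /eqP/(only x xs).
  by case/orP=> /eqP ->; rewrite ?x1s ?x2s ?f1 ?f2 fsu eqxx.
suff -> : [set x in s | f @: (s :\ x) == u] = set0 by rewrite cards0.
apply/setP => x; rewrite !inE; apply/negP => /andP[xs /eqP fxu].
by case/orP: (only x xs fxu) => /eqP xE; move: fsu; rewrite -fxu xE ?f1 ?f2 eqxx.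
Qed.

End BoundaryParity.

Lemma mulrn_odd (x : ('F_2)^o) m n : odd m = odd n -> x *+ m = x *+ n.
Proof.
have odd_eq p : x *+ p = x *+ odd p.
  rewrite -[in LHS](odd_double_half p) mulrnDr -mul2n mulrnA.
  suff -> : x *+ 2 = 0 by rewrite mul0rn addr0.
  by apply/val_inj; case: x => -[|[|m']] ?.
by move=> mn; rewrite odd_eq mn -odd_eq.
Qed.

Lemma chain_map_boundary (V W : finType) (K : simplicial_complex V) (L : simplicial_complex W)
    (f : simplicial_map K L) (k : nat) (c : chain K k.+1) :
  chain_map f (boundary c) = boundary (chain_map f c).
Proof.
apply/ffunP => u; rewrite !ffunE.
under eq_bigr do rewrite ffunE.
under [RHS]eq_bigr do rewrite ffunE.
rewrite (exchange_big_dep predT) //= [RHS](exchange_big_dep predT) //=.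
apply: eq_bigr => s _.
rewrite !sumr_const; apply: mulrn_odd.
have /andP[sK /eqP sk] := valP s.
have /andP[uL /eqP uk] := valP u.
transitivity (odd #|[set x in val s | f @: (val s :\ x) == val u]|).
  congr odd; exact: (@card_facets _ K k (val s) (fun r => f @: r == val u)).
rewrite (odd_facets _ sk uk).
have -> : #|[pred t : ksimplex L k.+1 | (val u \subset val t) && (f @: val s == val t)]|
    = #|[pred t : {set W} | ((t \in L) && (#|t| == k.+2)) && ((val u \subset t) && (f @: val s == t))]|.
  exact: (card_sig_pred _ (fun t => (val u \subset t) && (f @: val s == t))).
have [fk|fk] /= := boolP (#|f @: val s| == k.+2); last first.
  rewrite eq_card0 // => t; rewrite !inE; apply: contraNF fk.
  by case/andP=> /andP[_ tk] /andP[_ /eqP ->].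
have [us|us] := boolP (val u \subset f @: val s); last first.
  rewrite eq_card0 // => t; rewrite !inE; apply: contraNF us.
  by case/andP=> _ /andP[ut /eqP ->].
rewrite (@eq_card1 _ (f @: val s)) // => t; rewrite !inE.
apply/idP/eqP => [/andP[_ /andP[_ /eqP ->]] //|->].
by rewrite fk us eqxx (simplicial_mapP f).
Qed.

Lemma boundary_boundary (V : finType) (K : simplicial_complex V) (k : nat)
    (c : chain K k.+2) :
  boundary (boundary c) = 0.
Proof.
apply/ffunP => u; rewrite !ffunE.
under eq_bigr do rewrite ffunE.
rewrite (exchange_big_dep predT) //= big1 // => s _.
rewrite sumr_const -[RHS](mulr0n (c s)); apply: mulrn_odd.
have /andP[sK /eqP sk] := valP s.
have /andP[uK /eqP uk] := valP u.
rewrite (_ : #|_| = #|[set x in val s | val u \subset val s :\ x]|); last first.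
  exact: (@card_facets _ K k.+1 (val s) (fun r => val u \subset r)).
have [us|us] := boolP (val u \subset val s); last first.
  rewrite (_ : [set x in _ | _] = set0) ?cards0 //.
  apply/setP => x; rewrite !inE; apply: contraNF us => /andP[_ ux].
  exact: subset_trans ux (subsetDl _ _).
rewrite (_ : [set x in _ | _] = val s :\: val u); last first.
  apply/setP => x; rewrite !inE subsetD1 us /=; exact: andbC.
by rewrite cardsD (setIidPr us) sk uk (addnK k.+1 2).
Qed.

Definition cycles (V : finType) (K : simplicial_complex V) (k : nat) :
    {vspace chain K k} :=
  if k is k'.+1 then lker (linfun (@boundary V K k')) else fullv.

Definition boundaries (V : finType) (K : simplicial_complex V) (k : nat) :
    {vspace chain K k} :=
  limg (linfun (@boundary V K k)).

(* Cycles modulo boundaries: the boundaries are pulled back to the space of  *)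
(* cycles, which contains them by boundary_boundary.                         *)
Definition homology (V : finType) (K : simplicial_complex V) (k : nat) :=
  vquot (linfun (vsval : subvs_of (cycles K k) -> _) @^-1: boundaries K k)%VS.
HB.instance Definition _ V K k := GRing.Lmodule.on (@homology V K k).

Definition homology_class (V : finType) (K : simplicial_complex V) (k : nat)
    (z : subvs_of (cycles K k)) : homology K k := vproj _ z.

Fact homology_class_linear V K k : linear (@homology_class V K k).
Proof. exact: linearP. Qed.
HB.instance Definition _ V K k := GRing.isLinear.Build _ _ _ _
  (@homology_class V K k) (@homology_class_linear V K k).

Lemma homology_classP (V : finType) (K : simplicial_complex V) (k : nat)
    (x : homology K k) :
  exists z : subvs_of (cycles K k), x = homology_class z.
Proof. by exists (vrepr x); rewrite /homology_class vreprK. Qed.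

Lemma homology_class_eq0 (V : finType) (K : simplicial_complex V) (k : nat)
    (z : subvs_of (cycles K k)) :
  (homology_class z == 0 :> @homology V K k) = (vsval z \in boundaries K k).
Proof.
rewrite -(linear0 (@homology_class V K k)) vproj_eq subr0.
by rewrite -memv_preim lfunE.
Qed.

Definition cycle_map (V W : finType) (K : simplicial_complex V) (L : simplicial_complex W)
    (f : simplicial_map K L) (k : nat) (z : subvs_of (cycles K k)) :
    subvs_of (cycles L k) :=
  vsproj (cycles L k) (chain_map f (vsval z)).

(* Independent of the representative by homology_map_class, and linear by    *)
(* homology_map_linear.                                                      *)
Definition homology_map (V W : finType) (K : simplicial_complex V) (L : simplicial_complex W)
    (f : simplicial_map K L) (k : nat) (x : homology K k) : homology L k :=
  homology_class (cycle_map f (vrepr x)).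

Lemma cycle_mapE V W K L f k z :
  vsval (@cycle_map V W K L f k z) = chain_map f (vsval z).
Proof.
rewrite vsprojK //; have := subvsP z; rewrite /cycles.
case: k z => [|k] z; first by move=> _; exact: memvf.
rewrite !memv_ker !lfunE /= -chain_map_boundary => /eqP ->.
by rewrite linear0.
Qed.

Fact cycle_map_linear V W K L f k : linear (@cycle_map V W K L f k).
Proof. by move=> a x y; apply/val_inj; rewrite /= !cycle_mapE !linearP. Qed.
HB.instance Definition _ V W K L f k := GRing.isLinear.Build _ _ _ _
  (@cycle_map V W K L f k) (@cycle_map_linear V W K L f k).

Lemma homology_map_class V W K L f k z :
  @homology_map V W K L f k (homology_class z) =
  homology_class (cycle_map f z).
Proof.
apply/eqP; rewrite vproj_eq -linearB /= -memv_preim lfunE /= cycle_mapE.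
set d := _ - _; have : d \in (linfun vsval @^-1: boundaries K k)%VS.
  by rewrite -memvN opprB vreprP.
rewrite -memv_preim lfunE /= => /memv_imgP[b _ ->].
apply/memv_imgP; exists (chain_map f b); first exact: memvf.
by rewrite !lfunE /= chain_map_boundary.
Qed.

Fact homology_map_linear V W K L f k : linear (@homology_map V W K L f k).
Proof.
move=> a x y.
have [u ->] := homology_classP x; have [v ->] := homology_classP y.
rewrite -linearP !homology_map_class.
by rewrite (linearP (@cycle_map _ _ _ _ f k)) (linearP (@homology_class _ L k)).
Qed.
HB.instance Definition _ V W K L f k := GRing.isLinear.Build _ _ _ _
  (@homology_map V W K L f k) (@homology_map_linear V W K L f k).

(* The norm of the analysis library on 'rV[R]_n is the sup norm, not the       *)
(* Euclidean one.                                                              *)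
Definition eucl_dist (R : rcfType) (n : nat) (x y : 'rV[R]_n) : R :=
  Num.sqrt (\sum_(i < n) (x ord0 i - y ord0 i) ^+ 2).

Definition is_sparse (R : numDomainType) (T : choiceType) (d : T -> T -> R)
    (P : {fset T}) (delta : R) :=
  forall p1 p2, p1 \in P -> p2 \in P -> p1 != p2 -> delta <= d p1 p2.

(* Ties are broken arbitrarily: nu is any choice of nearest points.          *)
Definition nearest_point_map (R : numDomainType) (T : choiceType)
    (d : T -> T -> R) (P Q : {fset T}) (nu : P -> Q) :=
  forall (p : P) (q : Q), d (val p) (val (nu p)) <= d (val p) (val q).

Section Complexes.
Variables (R : rcfType) (n : nat) (alpha : R).
Implicit Types P Q : {fset 'rV[R]_n}.

Definition is_clique P (s : {set P}) : bool :=
  [forall p1 in s, forall p2 in s,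
     (p1 != p2) ==> (eucl_dist (val p1) (val p2) <= alpha)].

Lemma is_cliqueP P (s : {set P}) :
  reflect (forall p1 p2, p1 \in s -> p2 \in s -> p1 != p2 ->
             eucl_dist (val p1) (val p2) <= alpha)
          (is_clique s).
Proof.
apply: (iffP idP) => [/forall_inP h p1 p2 s1 s2|h].
  exact/implyP/(forall_inP (h p1 s1)).
by do 2!apply/forall_inP => ? ?; apply/implyP; exact: h.
Qed.

Lemma is_clique_sub P (s t : {set P}) :
  t \subset s -> is_clique s -> is_clique t.
Proof.
move=> /subsetP ts /is_cliqueP sC; apply/is_cliqueP => p1 p2 /ts s1 /ts s2.
exact: sC.
Qed.

Definition rips_simplices P : {set {set P}} :=
  [set s : {set P} | (s != set0) && is_clique s].

Fact rips_neq0 P s : s \in rips_simplices P -> s != set0.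
Proof. by rewrite inE => /andP[]. Qed.

Fact rips_sub P (s t : {set P}) : s \in rips_simplices P ->
  t \subset s -> t != set0 -> t \in rips_simplices P.
Proof.
by rewrite !inE => /andP[_ sC] ts -> /=; exact: is_clique_sub ts sC.
Qed.

Definition rips P := SimplicialComplex (@rips_neq0 P) (@rips_sub P).

Section GraphInduced.
Variables (P Q : {fset 'rV[R]_n}) (nu : P -> Q).

(* A set of k+1 points is a simplex when it is the image of a (k+1)-clique,  *)
(* so that nu is injective on this clique.                                   *)
Definition gic_simplices : {set {set Q}} :=
  [set t : {set Q} | (t != set0) &&
     [exists s : {set P}, [&& is_clique s, #|s| == #|t| & nu @: s == t]]].

Fact gic_neq0 t : t \in gic_simplices -> t != set0.
Proof. by rewrite inE => /andP[]. Qed.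

Lemma clique_image (s : {set P}) (t : {set Q}) :
  is_clique s -> t \subset nu @: s -> t != set0 -> t \in gic_simplices.
Proof.
move=> sC /subsetP ts t0; rewrite inE t0 /=; apply/existsP.
have pre q : q \in t -> exists2 p, p \in s & q = nu p.
  by move=> /ts /imsetP.
have [q0 q0t] := set0Pn _ t0; have [p0 p0s _] := pre q0 q0t.
pose g q := odflt p0 [pick p in s | q == nu p].
have gP q : q \in t -> g q \in s /\ nu (g q) = q.
  move=> /pre[p ps qE]; rewrite /g; case: pickP => [p' /andP[p's /eqP]//|/(_ p)].
  by rewrite /= ps qE eqxx.
exists (g @: t); apply/and3P; split.
- apply: is_clique_sub sC; apply/subsetP => _ /imsetP[q /gP[gs _] ->]; exact: gs.
- rewrite card_in_imset // => q q' /gP[_ qE] /gP[_ qE'] gqq'.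
  by rewrite -qE gqq' qE'.
- rewrite -imset_comp; apply/eqP/setP => q; apply/imsetP/idP.
    by case=> q' q't -> /=; have [_ ->] := gP q' q't.
  by move=> qt; exists q => //=; have [_ ->] := gP q qt.
Qed.

Fact gic_sub (s t : {set Q}) : s \in gic_simplices ->
  t \subset s -> t != set0 -> t \in gic_simplices.
Proof.
rewrite inE => /andP[_ /existsP[r /and3P[rC _ /eqP rs]]] ts.
by apply: clique_image rC _; rewrite rs.
Qed.

Definition gic := SimplicialComplex gic_neq0 gic_sub.

Fact gic_map_simplicial (s : {set P}) : s \in rips P -> nu @: s \in gic.
Proof.
rewrite inE => /andP[s0 sC]; apply: clique_image sC _ _ => //.
by rewrite imset_eq0.
Qed.

Definition gic_map : simplicial_map (rips P) gic :=
  SimplicialMap gic_map_simplicial.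

End GraphInduced.
End Complexes.

From mathcomp Require Import all_classical all_reals all_analysis.

Import numFieldNormedType.Exports.

Local Open Scope classical_set_scope.
Local Open Scope ring_scope.

Section Submanifold.
Variables (R : realType) (n : nat).
Implicit Types (U V M : set 'rV[R]_n) (f : 'rV[R]_n -> 'rV[R]_n).

Fixpoint Ck (k : nat) U f : Prop :=
  if k is k'.+1 then
    (forall x, U x -> differentiable f x) /\
    (forall v, Ck k' U (fun x => 'D_v f x))
  else forall x, U x -> {for x, continuous f}.

Definition smooth_on U f := forall k, Ck k U f.

Definition diffeomorphism U V (phi psi : 'rV[R]_n -> 'rV[R]_n) :=
  [/\ smooth_on U phi, smooth_on V psi,
      (forall x, U x -> V (phi x) /\ psi (phi x) = x) &
      (forall y, V y -> U (psi y) /\ phi (psi y) = y)].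

(* Every point of M has an open neighbourhood U that is mapped by a smooth    *)
(* diffeomorphism onto an open set V, with U `&` M mapped onto                *)
(* V `&` (R^m x {0}); in particular M has no boundary.                        *)
Definition smooth_submanifold (m : nat) M :=
  forall p, M p -> exists U V phi psi,
    [/\ open U, open V, U p, diffeomorphism U V phi psi &
        phi @` (U `&` M) =
        V `&` [set y | forall i : 'I_n, (m <= i)%N -> y ord0 i = 0]].

Definition nearest_points M (z : 'rV[R]_n) :=
  [set x | M x /\ forall y, M y -> eucl_dist z x <= eucl_dist z y].

Definition medial_axis M : set 'rV[R]_n :=
  closure [set z | exists x y,
    [/\ nearest_points M z x, nearest_points M z y & x != y]].

(* Equal to +oo when M or its medial axis is empty; a minimum otherwise, M   *)
(* being compact and the medial axis closed.                                 *)
Definition reach M : \bar R :=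
  ereal_inf [set (eucl_dist x z)%:E | x in M & z in medial_axis M].

End Submanifold.

Definition is_sample (R : realType) (T : choiceType) (d : T -> T -> R)
    (X : set T) (P : {fset T}) (eps : R) :=
  [set` P] `<=` X /\
  forall x, X x -> exists2 p, p \in P & d x p <= eps.

(* Main.v *)
(* Only compactness and positive reach rho of M matter. By Federer's inequality
   the nearest point projection pi onto M is 2-Lipschitz at distance at most
   rho / 2 from M, and a chord of length s <= 2 rho / 27 stays within s / 26 of
   M. Composing pi with a choice f of nearby sample points turns fine
   subdivisions of Euclidean triangles into chains of the Rips complex, so that
   a cycle of the Rips complex near a point of M, being coned off in R^n, is a
   boundary. On the other hand every p in P is joined to nu p by a path G p of
   edges that stay in the Voronoi cell of nu p. Sliding the endpoints of a chain
   along these paths makes lifts of cycles of the graph induced complex into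
   cycles, whence surjectivity. A cycle whose image under h bounds is, up to a
   boundary, a sum of cycles each of which lives in two adjacent cells, whence
   injectivity. *)
From HB Require Import structures.
Require Import Defs.
From mathcomp Require Import all_boot all_order all_algebra finmap.

Set Implicit Arguments.
Unset Strict Implicit.
Unset Printing Implicit Defensive.

Import Order.TTheory GRing.Theory Num.Theory.

Local Open Scope ring_scope.

(** * Mod 2 chains: simplices as basis chains, sliding along paths, supports *)

Section Chains.
Variables (V : finType) (K : simplicial_complex V).

Lemma chain_addxx k (c : chain K k) : c + c = 0.
Proof.
by apply/ffunP => t; rewrite !ffunE -mulr2n (@mulrn_odd _ 2 0).
Qed.

Lemma chain_addKK k (c d : chain K k) : c + (c + d) = d.
Proof. by rewrite addrA chain_addxx add0r. Qed.

(** The basis chain of [s]. It is 0 unless [s] is a [k]-simplex, so that degenerate edges and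
    collapsed images vanish by themselves. *)
Definition schain k (s : {set V}) : chain K k := [ffun t => (val t == s)%:R].

Lemma schain_eq0 k s : s \notin K \/ #|s| != k.+1 -> schain k s = 0.
Proof.
move=> sK; apply/ffunP => t; rewrite !ffunE; case: eqP => // ts.
by have := valP t; rewrite ts => /andP[s1 s2]; case: sK; rewrite ?s1 ?s2.
Qed.

Lemma chain_sum k (c : chain K k) : c = \sum_t c t *: schain k (val t).
Proof.
apply/ffunP => u; rewrite sum_ffunE (bigD1 u) //= big1 ?addr0 => [|t tu].
  by rewrite !ffunE eqxx /= [RHS]mulr1.
by rewrite !ffunE (inj_eq val_inj) eq_sym (negbTE tu) /= [LHS]mulr0.
Qed.

Lemma boundary_schain k s : s \in K -> #|s| = k.+2 ->
  boundary (schain k.+1 s) = \sum_(x in s) schain k (s :\ x).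
Proof.
move=> sK sk; apply/ffunP => t; rewrite ffunE sum_ffunE.
have sP : (s \in K) && (#|s| == k.+2) by rewrite sK sk /=.
have -> : \sum_(u : ksimplex K k.+1 | val t \subset val u) schain k.+1 s u =
    (val t \subset s)%:R.
  have [ts|ts] := boolP (val t \subset s).
    rewrite (bigD1 (exist _ s sP)) //= big1 ?addr0 ?ffunE ?eqxx // => u /andP[_ us].
    by rewrite ffunE; case: eqP => // uE; case/eqP: us; apply/val_inj.
  rewrite big1 // => u tu; rewrite ffunE; case: eqP => // us.
  by rewrite us (negbTE ts) in tu.
have /andP[tK /eqP tk] := valP t.
under eq_bigr do rewrite ffunE.
have [ts|ts] := boolP (val t \subset s); last first.
  rewrite big1 // => x xs; case: eqP => // tx.
  by move: ts; rewrite tx subsetDl.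
have : #|s :\: val t| == 1 by rewrite cardsD (setIidPr ts) sk tk subSnn.
case/cards1P => x sx; have : x \in s :\: val t by rewrite sx set11.
rewrite inE => /andP[xt xs].
have tE : val t = s :\ x by rewrite -sx setDDr setDv set0U; apply/esym/setIidPr.
rewrite (bigD1 x) //= tE eqxx big1 ?addr0 // => y /andP[ys yx].
case: eqP => // /setP /(_ x); rewrite !inE eqxx xs andbT /= => /esym/negbT.
by rewrite eq_sym yx.
Qed.

Definition vtx v := schain 0 [set v].
Definition edge a b := schain 1 [set a; b].

Lemma edgeC a b : edge a b = edge b a.
Proof. by rewrite /edge setUC. Qed.

Lemma edge_self a : edge a a = 0.
Proof. by apply: schain_eq0; right; rewrite setUid cards1. Qed.

Lemma boundary_edge a b : [set a; b] \in K -> boundary (edge a b) = vtx a + vtx b.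
Proof.
have [->|ab] := eqVneq a b; first by rewrite edge_self linear0 chain_addxx.
move=> abK; rewrite boundary_schain ?cards2 ?ab // big_setU1 ?inE //= big_set1.
rewrite addrC; congr (schain _ _ + schain _ _).
  by apply/setP => x; rewrite !inE; case: (eqVneq x b) => [->|];
    rewrite ?orbF ?andbF //= eq_sym (negbTE ab).
by apply/setP => x; rewrite !inE; case: (eqVneq x a) => [->|] //=; rewrite (negbTE ab).
Qed.

Lemma boundary_mem k (c : chain K k.+1) : boundary c \in boundaries K k.
Proof. by rewrite -[boundary c]lfunE memv_img // memvf. Qed.

Lemma boundariesP k (c : chain K k) :
  c \in boundaries K k -> exists b, c = boundary b.
Proof. by case/memv_imgP => b _ ->; exists b; rewrite lfunE. Qed.

(** Vertices may coincide, since a degenerate edge is 0 and equal edges cancel mod 2. This covers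
    images of triangles under maps that are not injective. *)
Lemma triangle_boundaries a b c : [set a; b; c] \in K ->
  edge a b + edge b c + edge a c \in boundaries K 1.
Proof.
have [->|ab] := eqVneq a b; first by rewrite edge_self add0r chain_addxx mem0v.
have [->|bc] := eqVneq b c.
  by rewrite edge_self addr0 chain_addxx mem0v.
have [<-|ac] := eqVneq a c; first by rewrite edge_self addr0 (edgeC b) chain_addxx mem0v.
move=> abcK.
have card3 : #|[set a; b; c]| = 3.
  by rewrite setUC cardsU1 cards2 !inE ab !(eq_sym c) (negbTE ac) (negbTE bc).
suff -> : edge a b + edge b c + edge a c = boundary (schain 2 [set a; b; c]).
  exact: boundary_mem.
rewrite boundary_schain // setUC big_setU1 ?inE ?negb_or ?(eq_sym c) ?ac ?bc //=.
rewrite big_setU1 ?inE //= big_set1 -addrA; congr (_ + (_ + _)); congr schain.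
- apply/setP => x; rewrite !inE; case: (eqVneq x c) => [->|] //=.
  by rewrite !(eq_sym c) (negbTE ac) (negbTE bc).
- apply/setP => x; rewrite !inE; case: (eqVneq x a) => [->|] /=.
    by rewrite (negbTE ab) (negbTE ac).
  by rewrite orbC.
- apply/setP => x; rewrite !inE; case: (eqVneq x b) => [->|] /=.
    by rewrite (eq_sym b) (negbTE ab) (negbTE bc).
  by rewrite orbF orbC.
Qed.

Lemma ksimplex1P (t : ksimplex K 1) :
  exists a b, [/\ a != b, val t = [set a; b] & [set a; b] \in K].
Proof.
have /andP[tK /cards2P[a [b [ab tE]]]] := valP t.
by exists a, b; rewrite -tE.
Qed.

Section VertexExtension.
Variable U : lmodType 'F_2.
Implicit Type g : V -> U.

(** The linear extension of [g] to 0-chains. The inner sum has a single term: it reads off the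
    vertex of a 0-simplex without a choice. *)
Definition vext g (c : chain K 0) : U := \sum_t c t *: \sum_(v in val t) g v.

Fact vext_linear g : linear (vext g).
Proof.
move=> a c d; rewrite scaler_sumr -big_split; apply: eq_bigr => t _ /=.
by rewrite !ffunE scalerDl scalerA.
Qed.
HB.instance Definition _ g :=
  GRing.isLinear.Build _ _ _ _ (vext g) (vext_linear g).

Lemma vext_vtx g v : [set v] \in K -> vext g (vtx v) = g v.
Proof.
move=> vK; have vP : ([set v] \in K) && (#|[set v]| == 1) by rewrite vK cards1.
rewrite /vext (bigD1 (exist _ [set v] vP)) //= [X in _ + X]big1 ?addr0 => [|t].
  by rewrite ffunE eqxx scale1r big_set1.
move=> tv; rewrite ffunE; case: eqP => [tE|]; last by rewrite scale0r.
by case/eqP: tv; apply/val_inj.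
Qed.

Lemma vext_edge g a b : [set a; b] \in K ->
  vext g (boundary (edge a b)) = g a + g b.
Proof.
move=> abK; rewrite boundary_edge // linearD /= !vext_vtx //.
  by apply: simplex_sub abK _ _; rewrite ?sub1set ?set22 // -card_gt0 cards1.
by apply: simplex_sub abK _ _; rewrite ?sub1set ?set21 // -card_gt0 cards1.
Qed.

Lemma vextD g1 g2 c : vext (fun v => g1 v + g2 v) c = vext g1 c + vext g2 c.
Proof.
by rewrite -big_split; apply: eq_bigr => t _; rewrite /= big_split scalerDr.
Qed.

End VertexExtension.

Lemma linear_vext (U W : lmodType 'F_2) (f : {linear U -> W}) g c :
  f (vext g c) = vext (f \o g) c.
Proof.
by rewrite linear_sum; apply: eq_bigr => t _; rewrite linearZ /= linear_sum.
Qed.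

Lemma eq_vext (U : lmodType 'F_2) (g1 g2 : V -> U) c :
  (forall v, [set v] \in K -> g1 v = g2 v) -> vext g1 c = vext g2 c.
Proof.
move=> g12; apply: eq_bigr => t _; congr (_ *: _); apply: eq_bigr => v vt.
have /andP[tK _] := valP t.
by apply: g12; apply: simplex_sub tK _ _; rewrite ?sub1set // -card_gt0 cards1.
Qed.

Lemma vext_vtxK c : vext vtx c = c.
Proof.
rewrite [RHS]chain_sum; apply: eq_bigr => t _; congr (_ *: _).
have /andP[_ /cards1P[v tE]] := valP t.
by rewrite tE big_set1.
Qed.

(** When [g v] is a path that starts at [v], each endpoint of an edge is moved to the other end of
    its path. Cycles do not change. *)
Definition slide (g : V -> chain K 1) (c : chain K 1) := c + vext g (boundary c).

Fact slide_linear g : linear (slide g).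
Proof. by move=> a c d; rewrite /slide !linearP scalerDr addrACA. Qed.
HB.instance Definition _ g :=
  GRing.isLinear.Build _ _ _ _ (slide g) (slide_linear g).

Lemma slide_edge g a b : [set a; b] \in K ->
  slide g (edge a b) = edge a b + (g a + g b).
Proof. by move=> abK; rewrite /slide vext_edge. Qed.

(** A coning argument when every [g a] is a path from [a] to a common apex: a cycle equals its own
    slide, which is a sum of loops through the apex, one for each edge. *)
Lemma cycle_boundaries g (z : chain K 1) : boundary z = 0 ->
  (forall (t : ksimplex K 1) a b, z t != 0 -> a != b -> val t = [set a; b] ->
     [set a; b] \in K -> edge a b + (g a + g b) \in boundaries K 1) ->
  z \in boundaries K 1.
Proof.
move=> z0 zg; have -> : z = slide g z by rewrite /slide z0 linear0 addr0.
rewrite [z]chain_sum linear_sum; apply: memv_suml => t _.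
have [->|zt] := eqVneq (z t) 0; first by rewrite scale0r linear0 mem0v.
rewrite linearZ memvZ //; have [a [b [ab tE abK]]] := ksimplex1P t.
by rewrite tE /= slide_edge //; exact: zg zt ab tE abK.
Qed.

Implicit Types A B s : {set V}.

Definition supported (A : {set V}) (c : chain K 1) :=
  forall t, c t != 0 -> val t \subset A.

Lemma supported_schain A s : s \subset A -> supported A (schain 1 s).
Proof. by move=> sA t; rewrite ffunE; case: (eqVneq (val t) s) => [->|_]; rewrite ?eqxx. Qed.

Lemma supported0 A : supported A 0.
Proof. by move=> t; rewrite ffunE eqxx. Qed.

Lemma supportedD A c d : supported A c -> supported A d -> supported A (c + d).
Proof.
move=> cA dA t; rewrite ffunE; have [ct|/cA//] := eqVneq (c t) 0.
by rewrite ct add0r => /dA.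
Qed.

Lemma supportedZ A x c : supported A c -> supported A (x *: c).
Proof.
by move=> cA t; rewrite ffunE; apply: contraNT => /(contraNeq (cA t)) ->; rewrite scaler0.
Qed.

Lemma supported_sub A B c : A \subset B -> supported A c -> supported B c.
Proof. by move=> AB cA t /cA /subset_trans; apply. Qed.

Lemma supported_sum A (I : finType) (F : I -> chain K 1) :
  (forall i, supported A (F i)) -> supported A (\sum_i F i).
Proof.
move=> FA; elim/big_ind: _ => //; [exact: supported0|exact: supportedD].
Qed.

Lemma supported_slide A g c : supported A c ->
  (forall v, v \in A -> supported A (g v)) -> supported A (slide g c).
Proof.
move=> cA gA; rewrite [c]chain_sum linear_sum; apply: supported_sum => t.
have [->|ct] := eqVneq (c t) 0; first by rewrite scale0r linear0; exact: supported0.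
rewrite linearZ; apply: supportedZ.
have [a [b [ab tE abK]]] := ksimplex1P t.
have := cA t ct; rewrite tE => abA; rewrite /= slide_edge //.
apply: supportedD; first exact: supported_schain.
by apply: supportedD; apply: gA; apply: (subsetP abA); rewrite ?set21 ?set22.
Qed.

End Chains.

(** * An algebraic criterion for a simplicial map to be bijective on first homology *)

Section ChainMaps.
Variables (V W : finType) (K : simplicial_complex V) (L : simplicial_complex W).
Variable h : simplicial_map K L.

Lemma chain_map_schain k s : s \in K -> #|s| = k.+1 ->
  chain_map h (schain K k s) = schain L k (h @: s).
Proof.
move=> sK sk; apply/ffunP => t; rewrite !ffunE.
have sP : (s \in K) && (#|s| == k.+1) by rewrite sK sk /=.
have [tE|tE] := eqVneq (val t) (h @: s).
  rewrite (bigD1 (exist _ s sP)) /= ?tE // ffunE eqxx big1 ?addr0 // => u.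
  by case/andP=> _ us; rewrite ffunE; case: eqP => // uE; case/eqP: us; apply/val_inj.
rewrite big1 // => u /eqP uE; rewrite ffunE; case: eqP => // us.
by move: tE; rewrite -uE us eqxx.
Qed.

Lemma vext_chain_map (U : lmodType 'F_2) (g : W -> U) c :
  vext g (chain_map h c) = vext (g \o h) c.
Proof.
rewrite [c]chain_sum !linear_sum; apply: eq_bigr => t _.
have /andP[tK /cards1P[v tE]] := valP t; rewrite tE in tK *.
rewrite !linearZ /= chain_map_schain ?cards1 // imset_set1.
by rewrite (vext_vtx g) ?vext_vtx // -(imset_set1 h) simplicial_mapP.
Qed.

Lemma chain_map_cell w c : supported (h @^-1: [set w]) c -> chain_map h c = 0.
Proof.
move=> cw; rewrite [c]chain_sum linear_sum big1 // => t _.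
have [->|ct] := eqVneq (c t) 0; first by rewrite scale0r linear0.
have /andP[tK /eqP tk] := valP t.
rewrite linearZ /= chain_map_schain // schain_eq0 ?scaler0 //; right.
apply/eqP => htk; have := subset_leq_card (imsetS h (cw t ct)).
rewrite htk leqNgt ltnS -(cards1 w) subset_leq_card //.
by apply/subsetP => _ /imsetP[v + ->]; rewrite !inE.
Qed.

Lemma homology_map_bijective :
  (forall z : chain K 1, boundary z = 0 -> chain_map h z \in boundaries L 1 ->
     z \in boundaries K 1) ->
  (forall w : chain L 1, boundary w = 0 ->
     exists2 z, boundary z = 0 & chain_map h z = w) ->
  bijective (@homology_map _ _ _ _ h 1).
Proof.
move=> h_inj h_surj.
have cyc (C : finType) (J : simplicial_complex C) (c : chain J 1) :
  (c \in cycles J 1) = (boundary c == 0) by rewrite memv_ker lfunE.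
have inj : injective (@homology_map _ _ _ _ h 1).
  move=> x y xy; apply/eqP; rewrite -subr_eq0.
  have : homology_map h (x - y) == 0 by rewrite linearB /= xy subrr.
  have [z ->] := homology_classP (x - y).
  rewrite homology_map_class !homology_class_eq0 cycle_mapE => /h_inj -> //.
  by apply/eqP; rewrite -cyc subvsP.
have surj y : exists x : homology K 1, homology_map h x == y.
  have [w ->] := homology_classP y.
  have /eqP w0 : boundary (vsval w) == 0 by rewrite -cyc subvsP.
  have [z z0 zw] := h_surj _ w0.
  exists (homology_class (vsproj (cycles K 1) z)); rewrite homology_map_class.
  apply/eqP; congr homology_class; apply/val_inj; rewrite /= cycle_mapE vsprojK //.
  by rewrite cyc z0.
exists (fun y => xchoose (surj y)) => [x|y].
  by apply: inj; apply/eqP; exact: (xchooseP (surj (homology_map h x))).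
by apply/eqP; exact: (xchooseP (surj y)).
Qed.

Variables (iota : W -> V) (lift : {set W} -> {set V}) (G : V -> chain K 1).
Hypothesis liftP : forall s, s \in L ->
  [/\ lift s \in K, #|lift s| = #|s| & h @: lift s = s].
Hypothesis boundary_G : forall v, [set v] \in K ->
  boundary (G v) = vtx K v + vtx K (iota (h v)).
Hypothesis supported_G : forall v, supported (h @^-1: [set h v]) (G v).

(** A right inverse of [chain_map h], but in general no chain map: lifts of the faces of a simplex
    need not be faces of its lift. Sliding along [G] makes up for this. *)
Definition chain_lift k (c : chain L k) : chain K k :=
  \sum_t c t *: schain K k (lift (val t)).

Fact chain_lift_linear k : linear (@chain_lift k).
Proof.
move=> a c d; rewrite scaler_sumr -big_split; apply: eq_bigr => t _ /=.
by rewrite !ffunE scalerDl scalerA.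
Qed.
HB.instance Definition _ k :=
  GRing.isLinear.Build _ _ _ _ (@chain_lift k) (@chain_lift_linear k).

Lemma chain_liftK k (c : chain L k) : chain_map h (chain_lift c) = c.
Proof.
rewrite [RHS]chain_sum linear_sum; apply: eq_bigr => t _.
have /andP[tL /eqP tk] := valP t; have [lK lk hl] := liftP tL.
rewrite linearZ /=; congr (_ *: _).
by rewrite (chain_map_schain lK) ?hl // lk tk.
Qed.

(** Sliding along [G] carries each boundary vertex [v] to [iota (h v)], so that the new boundary
    depends only on the image of [c]. *)
Lemma boundary_slide c :
  boundary (slide G c) = vext (vtx K \o iota) (boundary (chain_map h c)).
Proof.
rewrite -chain_map_boundary vext_chain_map linearD /= linear_vext.
rewrite (eq_vext (g2 := fun v => vtx K v + vtx K (iota (h v)))) //.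
by rewrite vextD vext_vtxK chain_addKK.
Qed.

(** Each path [G v] stays in one fiber of [h] and is therefore collapsed. *)
Lemma chain_map_slide c : chain_map h (slide G c) = chain_map h c.
Proof.
rewrite linearD /= linear_vext (eq_vext (g2 := fun=> 0)); last first.
  by move=> v _ /=; exact: (chain_map_cell (@supported_G v)).
rewrite /vext big1 ?addr0 // => t _.
by rewrite big1 ?scaler0.
Qed.

Lemma chain_map_surj (w : chain L 1) : boundary w = 0 ->
  exists2 z, boundary z = 0 & chain_map h z = w.
Proof.
move=> w0; exists (slide G (chain_lift w)).
  by rewrite boundary_slide chain_liftK w0 linear0.
by rewrite chain_map_slide chain_liftK.
Qed.

Hypothesis local_cycles : forall a b (c : chain K 1), [set a; b] \in K ->
  boundary c = 0 -> supported (h @^-1: [set h a; h b]) c -> c \in boundaries K 1.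

Lemma chain_map_inj (z : chain K 1) : boundary z = 0 ->
  chain_map h z \in boundaries L 1 ->
  z \in boundaries K 1.
Proof.
move=> z0 /boundariesP[w hz].
(* Adding the boundary of a lift of [w] keeps the class of [z] and makes its image exactly 0. *)
pose y := z + boundary (chain_lift w).
suff yB : y \in boundaries K 1.
  by rewrite -(rpredDr z (boundary_mem (chain_lift w))).
have y0 : boundary y = 0 by rewrite linearD /= z0 boundary_boundary addr0.
have hy : chain_map h y = 0.
  by rewrite linearD /= chain_map_boundary chain_liftK hz chain_addxx.
(* The added lift is 0 for [y] as a whole, but not for a single edge [e]. There
   [e + chain_lift (chain_map h e)] has image 0, so its slide is a cycle, and this cycle lives over
   the two endpoints of the image of [e]. *)
have -> : y = slide G (y + chain_lift (chain_map h y)).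
  by rewrite hy linear0 addr0 /slide y0 linear0 addr0.
rewrite [y]chain_sum !linear_sum -big_split linear_sum; apply: memv_suml => t _.
rewrite /= !linearZ -scalerDr linearZ memvZ //=; set e := schain _ _ _.
have [a [b [ab tE abK]]] := ksimplex1P t; apply: local_cycles abK _ _.
  by rewrite boundary_slide linearD /= chain_liftK chain_addxx !linear0.
have tA : val t \subset h @^-1: [set h a; h b].
  by rewrite tE; apply/subsetP => v; rewrite !inE => /orP[] /eqP ->; rewrite eqxx ?orbT.
apply: supported_slide.
  apply: supportedD; first exact: supported_schain.
  apply: supported_sum => u; have [->|ue] := eqVneq (chain_map h e u) 0.
    by rewrite scale0r; exact: supported0.
  apply: supportedZ; apply: supported_schain.
  have /andP[uL _] := valP u; have [_ _ hl] := liftP uL.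
  have /andP[tK /eqP tk] := valP t.
  move: ue; rewrite chain_map_schain // ffunE.
  case: (eqVneq (val u) _) => [uE _|]; last by rewrite eqxx.
  apply/subsetP => v /(imset_f h); rewrite hl uE inE tE imsetU1 imset_set1 !inE.
  by [].
move=> v; rewrite !inE => vA; apply: supported_sub (@supported_G v).
by apply/subsetP => x; rewrite !inE => /eqP ->.
Qed.

End ChainMaps.

From mathcomp Require Import all_classical all_reals all_analysis.
From mathcomp Require Import ring lra.

Import numFieldNormedType.Exports.

Local Open Scope classical_set_scope.
Local Open Scope ring_scope.

(** * The Euclidean inner product and norm, with the induced continuity and compactness *)

Section Euclidean.
Variables (R : realType) (n : nat).
Implicit Types x y z : 'rV[R]_n.

Definition dot x y : R := \sum_(i < n) x ord0 i * y ord0 i.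

Lemma dotC x y : dot x y = dot y x.
Proof. by apply: eq_bigr => i _; rewrite mulrC. Qed.

Lemma dotDl x y z : dot (x + y) z = dot x z + dot y z.
Proof. by rewrite -big_split; apply: eq_bigr => i _; rewrite mxE mulrDl. Qed.

Lemma dotZl a x y : dot (a *: x) y = a * dot x y.
Proof. by rewrite mulr_sumr; apply: eq_bigr => i _; rewrite mxE mulrA. Qed.

Lemma dotDr x y z : dot z (x + y) = dot z x + dot z y.
Proof. by rewrite !(dotC z) dotDl. Qed.

Lemma dotZr a x y : dot x (a *: y) = a * dot x y.
Proof. by rewrite dotC dotZl dotC. Qed.

Lemma dotNl x y : dot (- x) y = - dot x y.
Proof. by rewrite -scaleN1r dotZl mulN1r. Qed.

Lemma dotNr x y : dot x (- y) = - dot x y.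
Proof. by rewrite dotC dotNl dotC. Qed.

Definition dotE := (dotDl, dotDr, dotNl, dotNr, dotZl, dotZr).

Lemma dot_ge0 x : 0 <= dot x x.
Proof. by apply: sumr_ge0 => i _; rewrite -expr2 sqr_ge0. Qed.

Lemma dot_eq0 x : dot x x = 0 -> x = 0.
Proof.
move=> /eqP; rewrite psumr_eq0 => [/allP h|i _]; last by rewrite -expr2 sqr_ge0.
apply/rowP => i; have := h i (mem_index_enum i).
by rewrite -expr2 sqrf_eq0 mxE => /eqP.
Qed.

Definition enorm x : R := Num.sqrt (dot x x).

Lemma eucl_distE x y : eucl_dist x y = enorm (x - y).
Proof.
by congr Num.sqrt; apply: eq_bigr => i _; rewrite !mxE expr2.
Qed.

Lemma enorm_ge0 x : 0 <= enorm x.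
Proof. exact: sqrtr_ge0. Qed.
Hint Resolve enorm_ge0 : core.

Lemma enorm_sqr x : enorm x ^+ 2 = dot x x.
Proof. by rewrite sqr_sqrtr ?dot_ge0. Qed.

Lemma enorm0 : enorm 0 = 0.
Proof. by rewrite /enorm -(scale0r 0) dotZl mul0r sqrtr0. Qed.

Lemma enorm_eq0 x : enorm x = 0 -> x = 0.
Proof. by move=> x0; apply: dot_eq0; rewrite -enorm_sqr x0 expr0n. Qed.

Lemma enormN x : enorm (- x) = enorm x.
Proof. by rewrite /enorm dotNl dotNr opprK. Qed.

Lemma enorm_distC x y : enorm (x - y) = enorm (y - x).
Proof. by rewrite -enormN opprB. Qed.

Lemma enormZ a x : enorm (a *: x) = `|a| * enorm x.
Proof.
by rewrite /enorm dotZl dotZr mulrA -expr2 sqrtrM ?sqr_ge0 // sqrtr_sqr.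
Qed.

Lemma enorm_le_sqr x c : 0 <= c -> (enorm x <= c) = (dot x x <= c ^+ 2).
Proof. by move=> c0; rewrite -enorm_sqr ler_sqr // nnegrE. Qed.

Lemma dot_le_enorm x y : dot x y <= enorm x * enorm y.
Proof.
have [x0|x0] := eqVneq (enorm x) 0.
  by rewrite x0 (enorm_eq0 x0) -(scale0r 0) dotZl !mul0r.
have [y0|y0] := eqVneq (enorm y) 0.
  by rewrite y0 (enorm_eq0 y0) -(scale0r 0) dotZr mul0r mulr0.
have {}x0 : 0 < enorm x by rewrite lt_neqAle eq_sym x0 enorm_ge0.
have {}y0 : 0 < enorm y by rewrite lt_neqAle eq_sym y0 enorm_ge0.
have := dot_ge0 (enorm y *: x - enorm x *: y).
rewrite !dotE -!enorm_sqr (dotC y x); set a := enorm x; set b := enorm y.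
have ab : 0 < a * b by rewrite mulr_gt0.
move=> h; rewrite -(ler_pM2l ab); nra.
Qed.

Lemma enormD x y : enorm (x + y) <= enorm x + enorm y.
Proof.
rewrite enorm_le_sqr ?addr_ge0 // !dotE -!enorm_sqr (dotC y x).
have := dot_le_enorm x y; nra.
Qed.

Lemma enorm_dist_triangle z x y : enorm (x - y) <= enorm (x - z) + enorm (z - y).
Proof. by have := enormD (x - z) (z - y); rewrite addrA subrK. Qed.

Definition convex_comb (l : R) x y := (1 - l) *: x + l *: y.

Lemma enorm_convex_comb c l x y r : 0 <= l <= 1 ->
  enorm (x - c) <= r -> enorm (y - c) <= r -> enorm (convex_comb l x y - c) <= r.
Proof.
move=> /andP[l0 l1] xr yr.
have -> : convex_comb l x y - c = (1 - l) *: (x - c) + l *: (y - c).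
  by apply/rowP => i; rewrite !mxE; ring.
apply: le_trans (enormD _ _) _; rewrite !enormZ !ger0_norm ?subr_ge0 //.
nra.
Qed.

Lemma entry_le_norm x i : `|x ord0 i| <= `|x|.
Proof.
rewrite [leRHS]/Num.Def.normr /= mx_normrE.
by apply/bigmax_geP; right => /=; exists (ord0, i).
Qed.

Lemma enorm_le_norm x : enorm x <= Num.sqrt n%:R * `|x|.
Proof.
rewrite enorm_le_sqr ?mulr_ge0 ?sqrtr_ge0 // exprMn sqr_sqrtr ?ler0n //.
rewrite -[n in n%:R]card_ord -sum1_card natr_sum mulr_suml.
apply: ler_sum => i _; rewrite mul1r -expr2 -real_normK ?num_real //.
by rewrite ler_sqr ?nnegrE // entry_le_norm.
Qed.

Lemma norm_le_enorm x : `|x| <= enorm x.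
Proof.
rewrite [leLHS]/Num.Def.normr /= mx_normrE; apply/bigmax_leP; split => // -[j i] _ /=.
rewrite ord1 -sqrtr_sqr ler_wsqrtr // /dot (bigD1 i) //= -expr2 lerDl.
by apply: sumr_ge0 => k _; rewrite -expr2 sqr_ge0.
Qed.

Lemma enorm_lipschitz_continuous (f : 'rV[R]_n -> R) c :
  (forall x y, f x - f y <= c * enorm (x - y)) -> continuous f.
Proof.
move=> fc x; apply/(@cvgrPdist_lt _ _ _ _ (nbhs_filter x)) => e e0.
pose k := `|c| * Num.sqrt n%:R + 1.
have k0 : 0 < k by rewrite ltr_wpDl ?mulr_ge0 ?sqrtr_ge0.
apply: (@filterS _ _ (nbhs_filter x) (ball x (e / k))); last first.
  by apply: nbhsx_ballx; rewrite divr_gt0.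
move=> y; rewrite -ball_normE /= => xy.
have {}fc a b : f a - f b <= k * `|a - b|.
  apply: le_trans (fc a b) _; rewrite mulrDl -mulrA mul1r.
  apply: ler_wpDr => //; apply: le_trans (ler_wpM2r (enorm_ge0 _) (ler_norm c)) _.
  exact: ler_wpM2l (enorm_le_norm _).
apply: (@le_lt_trans _ _ (k * `|x - y|)).
  by rewrite ler_norml fc andbT lerNl opprB distrC fc.
by rewrite mulrC -ltr_pdivlMr.
Qed.

Lemma enorm_sub_continuous c : continuous (fun x => enorm (x - c)).
Proof.
apply: (@enorm_lipschitz_continuous _ 1) => x y; rewrite mul1r lerBlDr.
exact: enorm_dist_triangle.
Qed.

Lemma closed_enorm_le c r : closed [set x | enorm (x - c) <= r].
Proof.
apply: (@closed_comp _ _ (fun x => enorm (x - c)) [set t | t <= r]).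
  by move=> x _; exact: enorm_sub_continuous.
exact: closed_le.
Qed.

Lemma closed_enorm_ge c r : closed [set x | r <= enorm (x - c)].
Proof.
apply: (@closed_comp _ _ (fun x => enorm (x - c)) [set t | r <= t]).
  by move=> x _; exact: enorm_sub_continuous.
exact: closed_ge.
Qed.

Lemma compact_enorm_le c r : compact [set x | enorm (x - c) <= r].
Proof.
apply: bounded_closed_compact; last exact: closed_enorm_le.
exists (`|c| + r); split; first exact: num_real.
move=> t rt x /= xr; apply: le_trans (ltW rt).
rewrite -[x in leLHS](subrK c) addrC; apply: le_trans (ler_normD _ _) _.
by rewrite lerD2l (le_trans (norm_le_enorm _)).
Qed.

End Euclidean.
#[export] Hint Resolve enorm_ge0 : core.

(** * Nearest point projection onto a set of positive reach *)

Section Reach.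
Variables (R : realType) (n : nat) (M : set 'rV[R]_n).
Implicit Types x y z m : 'rV[R]_n.

Lemma nearest_point_exists z : compact M -> M !=set0 ->
  exists x, nearest_points M z x.
Proof.
move=> cM M0.
have cz : {within M, continuous (fun x => enorm (x - z))}.
  exact/continuous_subspaceT/enorm_sub_continuous.
have [x /set_mem Mx xmin] := EVT_min_rV M0 cM cz.
exists x; split => // y My; rewrite !eucl_distE !(enorm_distC z).
exact/xmin/mem_set.
Qed.

(** With two nearest points, [z] would lie on the medial axis, hence at distance at least the reach
    from [x]. *)
Lemma reach_nearest_unique (rho : R) z x y : (rho%:E <= reach M)%E ->
  nearest_points M z x -> nearest_points M z y -> eucl_dist z x < rho -> x = y.
Proof.
move=> rhoM zx zy; apply: contraPP => /eqP xy; apply/negP; rewrite -leNgt.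
rewrite -lee_fin; apply: le_trans rhoM _; apply: ereal_inf_lbound.
exists x; first by case: zx.
exists z; last by rewrite !eucl_distE enorm_distC.
by apply: subset_closure; exists x, y.
Qed.

Variables (pi : 'rV[R]_n -> 'rV[R]_n) (rho : R).
Hypothesis compactM : compact M.
Hypothesis piP : forall z, nearest_points M z (pi z).
Hypothesis nearest_unique : forall z x,
  nearest_points M z x -> enorm (z - pi z) < rho -> x = pi z.

Local Notation d z := (enorm (z - pi z)).

Lemma pi_in z : M (pi z).
Proof. by case: (piP z). Qed.

Lemma pi_le z m : M m -> d z <= enorm (z - m).
Proof. by move=> Mm; case: (piP z) => _ /(_ m Mm); rewrite !eucl_distE. Qed.

Lemma dist_lipschitz x y : d x - d y <= enorm (x - y).
Proof.
rewrite lerBlDr; apply: le_trans (pi_le x (pi_in y)) _.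
exact: enorm_dist_triangle.
Qed.

(** By compactness and uniqueness of [pi x], the points of [M] at distance at least [k] from [pi x]
    are farther from [x] than [pi x] by a positive gap. If [y] is within a third of this gap from
    [x], none of them can be nearest to [y]. *)
Lemma pi_continuous x (k : R) : d x < rho -> 0 < k ->
  exists2 t, 0 < t & forall y, enorm (y - x) <= t -> enorm (pi y - pi x) < k.
Proof.
move=> xrho k0.
pose K := M `&` [set m | k <= enorm (m - pi x)].
have [K0|/set0P nK0] := eqVneq K set0.
  exists 1 => // y _; rewrite ltNge; apply/negP => yk.
  have : K (pi y) by split => //; exact: pi_in.
  by rewrite K0.
have cK : compact K.
  apply: subclosed_compact compactM _ => [|m []//].
  by apply: closedI; [exact: compact_closed|exact: closed_enorm_ge].
have cf : {within K, continuous (fun m => enorm (m - x))}.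
  exact/continuous_subspaceT/enorm_sub_continuous.
have [m /set_mem [Mm km] mmin] := EVT_min_rV nK0 cK cf.
have dm : d x < enorm (m - x).
  rewrite lt_neqAle (enorm_distC m) pi_le // andbT; apply/eqP => dE.
  have mE : m = pi x.
    apply: nearest_unique => //; split => // y My.
    by rewrite !eucl_distE -dE pi_le.
  by move: km; rewrite /= mE subrr enorm0 leNgt k0.
exists ((enorm (m - x) - d x) / 3) => [|y yt]; first by rewrite divr_gt0 ?subr_gt0.
rewrite ltNge; apply/negP => yk.
have /mem_set /mmin h1 : K (pi y) by split => //; exact: pi_in.
have h2 := dist_lipschitz y x.
have h3 := enorm_dist_triangle y (pi y) x.
rewrite (enorm_distC (pi y) y) in h3.
lra.
Qed.

(* At a point where the nearest point is unique, the gradient of the distance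
   to M is the unit vector pointing away from it. *)
Lemma dist_ascent x (theta t0 : R) : 0 < d x -> d x < rho ->
  0 < theta < 1 -> 0 < t0 ->
  exists2 t, 0 < t <= t0 & d x + theta * t < d (x + (t / d x) *: (x - pi x)).
Proof.
move=> d0 drho /andP[th0 th1] t00.
(* The tolerance for the motion of [pi]: by Cauchy-Schwarz it keeps [dot (x - pi x) (x - q)] above
   [theta * d x ^+ 2]. *)
have k0 : 0 < (1 - theta) * d x by rewrite mulr_gt0 ?subr_gt0.
have [t1 t10 tpi] := pi_continuous drho k0.
pose t := Num.min t0 t1.
have t_gt0 : 0 < t by rewrite lt_min t00.
have tt0 : t <= t0 by rewrite ge_min lexx.
have tt1 : t <= t1 by rewrite ge_min lexx orbT.
clearbody t; exists t; first by rewrite t_gt0.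
set y := x + _ *: _.
have xy : enorm (y - x) <= t1.
  have -> : y - x = (t / d x) *: (x - pi x) by rewrite [LHS]addrC /y addKr.
  rewrite enormZ ger0_norm ?(divr_ge0 (ltW _) (ltW _)) //.
  by rewrite divfK ?gt_eqF.
have := tpi y xy; set q := pi y => qk.
have h1 : d x ^+ 2 <= dot (x - q) (x - q).
  by rewrite -enorm_sqr ler_sqr ?nnegrE ?enorm_ge0 //; apply/pi_le/pi_in.
have h2 : d x ^+ 2 - (1 - theta) * d x * d x < dot (x - pi x) (x - q).
  have -> : x - q = (x - pi x) - (q - pi x) by rewrite opprB addrA subrK.
  rewrite dotDr dotNr -enorm_sqr ltrD2l ltrN2.
  apply: le_lt_trans (dot_le_enorm _ _) _.
  by rewrite mulrC ltr_pM2r.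
rewrite -ltr_sqr ?nnegrE ?addr_ge0 ?mulr_ge0 ?enorm_ge0 ?(ltW th0) ?(ltW t_gt0) //.
have -> : d y ^+ 2 =
    dot (x - q) (x - q) + 2 * (t / d x) * dot (x - pi x) (x - q) + t ^+ 2.
  rewrite enorm_sqr.
  have -> : y - pi y = (x - q) + (t / d x) *: (x - pi x) by rewrite /y addrAC.
  rewrite dotDl !(dotDr (x - q)) !dotZl !dotZr.
  rewrite (dotC (x - q) (x - pi x)) -(enorm_sqr (x - pi x)).
  field.
  by rewrite gt_eqF.
have h3 : 2 * (t / d x) * (theta * d x ^+ 2) <
          2 * (t / d x) * dot (x - pi x) (x - q).
  rewrite ltr_pM2l ?mulr_gt0 ?invr_gt0 //; lra.
have h4 : 2 * (t / d x) * (theta * d x ^+ 2) = 2 * t * theta * d x.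
  by field; rewrite gt_eqF.
have h5 : theta ^+ 2 * t ^+ 2 <= t ^+ 2.
  rewrite ler_piMl ?sqr_ge0 // expr_le1 ?ltW //.
nra.
Qed.

(** In place of a gradient flow, [d x - theta * enorm (x - x0)] is maximized over the ball of radius
    [rho - d x0] around [x0]. A maximizer lies on the sphere and is almost as far from [pi x0] as
    the triangle inequality permits, hence close to the point on the ray. Then [theta] tends to
    1. *)
Lemma dist_extend x0 : 0 < d x0 -> d x0 < rho ->
  rho <= d (pi x0 + (rho / d x0) *: (x0 - pi x0)).
Proof.
set r := d x0; set p := pi x0 => r0 rrho.
pose s := rho - r; have s0 : 0 < s by rewrite subr_gt0.
set x' := p + _.
have x'E : x' = x0 + (s / r) *: (x0 - p).
  apply/rowP => i; rewrite /x' /s !mxE; move: (x0 ord0 i) (p ord0 i) => u v.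
  by field; rewrite gt_eqF.
(* Chosen so that a maximizer has squared distance at most [(1 - theta) * C] from [x']. *)
pose C := 2 * s ^+ 2 + 2 * s ^+ 3 / r.
have C0 : 0 < C by rewrite addr_gt0 ?divr_gt0 ?mulr_gt0 ?exprn_gt0.
have key theta : 0 < theta < 1 ->
    exists2 g, rho <= d x' + (1 - theta) * s + g & 0 <= g /\ g ^+ 2 <= (1 - theta) * C.
  move=> th; have /andP[th0 th1] := th.
  pose f x := d x - theta * enorm (x - x0).
  have cf : continuous f.
    apply: (@enorm_lipschitz_continuous _ _ _ (1 + theta)) => x y.
    have := dist_lipschitz x y; have := enorm_dist_triangle x y x0.
    rewrite (enorm_distC y x) /f; nra.
  have B0 : [set x | enorm (x - x0) <= s] !=set0.
    by exists x0; rewrite /= subrr enorm0 ltW.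
  have [x /set_mem /= xs xmax] :=
    EVT_max_rV B0 (@compact_enorm_le _ _ x0 s) (continuous_subspaceT cf).
  have fx : r + theta * enorm (x - x0) <= d x.
    have : x0 \in [set x | enorm (x - x0) <= s].
      by apply/mem_set; rewrite /= subrr enorm0 ltW.
    by move=> /xmax; rewrite /f subrr enorm0 mulr0 subr0 lerBrDr.
  (* A maximizer inside the ball would still be at distance less than [rho] from [M], and
     [dist_ascent] would improve it. *)
  have xsE : enorm (x - x0) = s.
    apply/eqP; rewrite eq_le xs /= leNgt; apply/negP => xs'.
    have dx0 : 0 < d x.
      by apply: lt_le_trans r0 (le_trans _ fx); rewrite lerDl mulr_ge0 ?enorm_ge0 // ltW.
    have dxrho : d x < rho.
      by have := dist_lipschitz x x0; rewrite -/p -/r; rewrite /s in xs'; lra.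
    have t0 : 0 < s - enorm (x - x0) by rewrite subr_gt0.
    have [t /andP[tgt0 tle]] := dist_ascent dx0 dxrho th t0.
    set y := x + _ *: _ => dy.
    have yx0 : enorm (y - x0) <= enorm (x - x0) + t.
      have -> : y - x0 = (x - x0) + (t / d x) *: (x - pi x) by rewrite /y addrAC.
      apply: le_trans (enormD _ _) _; rewrite lerD2l enormZ.
      rewrite ger0_norm ?divr_ge0 ?enorm_ge0 ?(ltW tgt0) //.
      by rewrite divfK ?gt_eqF.
    have : y \in [set x | enorm (x - x0) <= s].
      by apply/mem_set => /=; apply: le_trans yx0 _; rewrite addrC -lerBrDr.
    move=> /xmax; rewrite /f leNgt => /negP; apply.
    have : theta * enorm (y - x0) <= theta * (enorm (x - x0) + t).
      by rewrite ler_pM2l.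
    rewrite mulrDr; lra.
  exists (enorm (x - x')).
    have := dist_lipschitz x x'; rewrite xsE in fx.
    by have : rho = r + s; [rewrite /s addrC subrK|lra].
  split; first exact: enorm_ge0.
  have xp : r + theta * s <= enorm (x - p).
    by rewrite -xsE (le_trans fx) // pi_le //; exact: pi_in.
  have {}xp : (r + theta * s) ^+ 2 <= enorm (x - p) ^+ 2.
    by rewrite ler_sqr ?nnegrE ?enorm_ge0 // addr_ge0 ?mulr_ge0 // ltW.
  have wE : dot (x - x0) (x - x0) = s ^+ 2 by rewrite -enorm_sqr xsE.
  have vE : dot (x0 - p) (x0 - p) = r ^+ 2 by rewrite -enorm_sqr.
  move: xp wE vE; rewrite (enorm_sqr (x - p)) enorm_sqr x'E.
  have -> : x - p = (x - x0) + (x0 - p) by rewrite addrA subrK.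
  have -> : x - (x0 + (s / r) *: (x0 - p)) = (x - x0) - (s / r) *: (x0 - p).
    by rewrite opprD addrA.
  move: (x - x0) (x0 - p) => w v.
  rewrite !dotE (dotC v w) => h wE vE; rewrite {}wE {}vE in h *.
  move: (dot w v) h => c h.
  have k0 : 0 < s / r by rewrite divr_gt0.
  have sE : s = (s / r) * r by rewrite divfK ?gt_eqF.
  have CE : C = 2 * s ^+ 2 + 2 * (s / r) * s ^+ 2 by rewrite /C; field; rewrite gt_eqF.
  rewrite CE; move: (s / r) k0 sE => k k0 sE.
  have : k * ((r + theta * s) ^+ 2) <= k * (s ^+ 2 + c + (c + r ^+ 2)) by rewrite ler_pM2l.
  have : 0 <= (1 - theta) ^+ 2 * s ^+ 2 * k.
    by rewrite mulr_ge0 ?(ltW k0) // mulr_ge0 ?sqr_ge0.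
  rewrite {}sE; nra.
rewrite leNgt; apply/negP => dx'.
pose g := rho - d x'; have g0 : 0 < g by rewrite subr_gt0.
(* For [theta = 1 - D^-1] both errors, [D^-1 * s] and the distance of the maximizer from [x'], fall
   below half the gap [g]. *)
pose D := 1 + 2 * s / g + 4 * C / g ^+ 2.
have a0 : 0 < 2 * s / g by rewrite divr_gt0 ?mulr_gt0.
have b0 : 0 < 4 * C / g ^+ 2 by rewrite divr_gt0 ?mulr_gt0 ?exprn_gt0.
have D1 : 1 < D by rewrite /D; lra.
have D0 : 0 < D by lra.
have [|e he [e0 eC]] := key (1 - D^-1).
  rewrite subr_gt0 invf_lt1 // D1 /= gtrBl invr_gt0 //.
rewrite subKr in he eC.
have h1 : D^-1 * s < g / 2.
  rewrite mulrC ltr_pdivrMr //.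
  have -> : g / 2 * D = s + (g / 2) * (1 + 4 * C / g ^+ 2).
    by rewrite /D; field; rewrite gt_eqF.
  by rewrite ltrDl mulr_gt0 ?divr_gt0 // addr_gt0.
have h2 : e ^+ 2 < (g / 2) ^+ 2.
  apply: le_lt_trans eC _.
  rewrite mulrC ltr_pdivrMr //.
  have -> : (g / 2) ^+ 2 * D = C + (g / 2) ^+ 2 * (1 + 2 * s / g).
    by rewrite /D; field; rewrite gt_eqF.
  by rewrite ltrDl mulr_gt0 ?exprn_gt0 ?divr_gt0 // addr_gt0.
have h3 : e < g / 2 by rewrite -ltr_sqr // nnegrE // ltW // divr_gt0.
rewrite /g in h1 h3; lra.
Qed.

Hypothesis rho_gt0 : 0 < rho.

(* Federer's inequality: by [dist_extend], no point of M is inside the ball of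
   radius rho that touches M at [pi z] and whose center is in direction z. *)
Lemma federer z m : d z < rho -> M m ->
  2 * rho * dot (z - pi z) (m - pi z) <= d z * dot (m - pi z) (m - pi z).
Proof.
move=> zrho Mm; have [z0|z0] := eqVneq (d z) 0.
  by rewrite z0 (enorm_eq0 z0) -(scale0r 0) dotZl !mul0r mulr0.
have {}z0 : 0 < d z by rewrite lt_neqAle eq_sym z0 enorm_ge0.
have h := le_trans (dist_extend z0 zrho) (pi_le _ Mm).
have {h} : rho ^+ 2 <= enorm (pi z + (rho / d z) *: (z - pi z) - m) ^+ 2.
  by rewrite ler_sqr ?nnegrE ?enorm_ge0 // ltW.
have := enorm_sqr (z - pi z).
rewrite (enorm_sqr (_ - m)).
have -> : pi z + (rho / d z) *: (z - pi z) - m =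
    (rho / d z) *: (z - pi z) - (m - pi z).
  by apply/rowP => i; rewrite !mxE; ring.
move: (m - pi z) (z - pi z) (enorm (z - pi z)) z0 => v w r r0 wE.
rewrite !dotE (dotC v w) -wE.
have e : rho / r * (rho / r * r ^+ 2) = rho ^+ 2 by field; rewrite gt_eqF.
move=> h; rewrite mulrBr e in h.
have {}h : r * (2 * (rho / r) * dot w v) <= r * dot v v by rewrite ler_pM2l //; lra.
by have <- : r * (2 * (rho / r) * dot w v) = 2 * rho * dot w v by field; rewrite gt_eqF.
Qed.

(** Federer's inequalities at [z] for [pi w] and at [w] for [pi z] are added. Both distances being
    at most [rho / 2], the right sides absorb only half of [2 * rho * dot e e], where [e] is
    [pi w - pi z]; Cauchy-Schwarz bounds the other half. *)
Lemma pi_lipschitz z w : 2 * d z <= rho -> 2 * d w <= rho ->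
  enorm (pi z - pi w) <= 2 * enorm (z - w).
Proof.
move=> zr wr.
have h1 : 2 * rho * dot (z - pi z) (pi w - pi z) <=
          d z * dot (pi w - pi z) (pi w - pi z).
  by apply: federer; [move: rho_gt0 zr; have := enorm_ge0 (z - pi z); lra|exact: pi_in].
have h2 : 2 * rho * dot (w - pi w) (pi z - pi w) <=
          d w * dot (pi z - pi w) (pi z - pi w).
  by apply: federer; [move: rho_gt0 wr; have := enorm_ge0 (w - pi w); lra|exact: pi_in].
set e := pi w - pi z.
have eN : pi z - pi w = - e by rewrite opprB.
have wE : w - pi w = (z - pi z) - (z - w) - e.
  rewrite /e !opprB; apply/rowP => i; rewrite !mxE; ring.
rewrite -/e in h1; rewrite eN enormN; rewrite eN in h2; clearbody e.
have {}h2 : 2 * rho * (- dot (z - pi z) e + dot (z - w) e + dot e e) <=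
            d w * dot e e.
  have <- : dot (- e) (- e) = dot e e by rewrite dotNl dotNr opprK.
  apply: le_trans h2; rewrite {}wE; move: (z - pi z) (z - w) => v u.
  by rewrite !dotE; lra.
have h3 := dot_le_enorm (w - z) e; rewrite enorm_distC in h3.
have wzE : w - z = - (z - w) by rewrite opprB.
rewrite wzE dotNl in h3.
have eE := enorm_sqr e.
have [e0|e0] := eqVneq (enorm e) 0.
  by rewrite e0 mulr_ge0 ?enorm_ge0.
have {}e0 : 0 < enorm e by rewrite lt_neqAle eq_sym e0 enorm_ge0.
rewrite -(ler_pM2l e0) -expr2 eE.
have h4 : d z * dot e e <= rho / 2 * dot e e by rewrite ler_wpM2r ?dot_ge0 //; move: zr; lra.
have h5 : d w * dot e e <= rho / 2 * dot e e by rewrite ler_wpM2r ?dot_ge0 //; move: wr; lra.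
move: h1 h2 h3 h4 h5.
move: (dot (z - pi z) e) (dot (z - w) e) (dot e e) (enorm e) (enorm (z - w)) (d z) (d w).
move=> A B E e' D dz dw h1 h2 h3 h4 h5.
have h6 : 2 * rho * B + 2 * rho * E <= rho * E by lra.
have h7 : rho * (2 * B + E) <= 0 by lra.
have {}h7 : 2 * B + E <= 0 by move: h7; rewrite pmulr_rle0.
lra.
Qed.

(** Federer's inequalities at [z] for [a] and [b], with weights [1 - l] and [l], lose their linear
    terms and give [2 * rho * r <= r ^+ 2 + l * (1 - l) * s ^+ 2], for [r] the distance from [z] to
    [M] and [s] the length of the chord. As [r] and [s] are at most [2 / 27 * rho], the constant is
    [(2 - 2 / 27) / (2 / 27) = 26]. *)
Lemma dist_chord l a b : M a -> M b -> 0 <= l <= 1 ->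
  27 * enorm (a - b) <= 2 * rho ->
  26 * d (convex_comb l a b) <= l * enorm (a - b).
Proof.
move=> Ma Mb /andP[l0 l1]; set z := convex_comb l a b => ab.
have zE : z - a = - l *: (a - b).
  by apply/rowP => i; rewrite !mxE; ring.
have za : d z <= l * enorm (a - b).
  apply: le_trans (pi_le _ Ma) _.
  by rewrite zE enormZ normrN ger0_norm.
have s0 := enorm_ge0 (a - b); have dz0 := enorm_ge0 (z - pi z).
have lab : l * enorm (a - b) <= enorm (a - b) by rewrite ler_piMl.
have zrho : d z < rho by move: rho_gt0; lra.
have h1 := federer zrho Ma; have h2 := federer zrho Mb.
have [z0|z0] := eqVneq (d z) 0.
  by rewrite z0 mulr0 mulr_ge0.
have {}z0 : 0 < d z by rewrite lt_neqAle eq_sym z0 enorm_ge0.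
have vE := enorm_sqr (z - pi z).
have abE := enorm_sqr (a - b).
have aE : a - pi z = (z - pi z) + l *: (a - b).
  by apply/rowP => i; rewrite !mxE; ring.
have bE : b - pi z = (z - pi z) + (l - 1) *: (a - b).
  by apply/rowP => i; rewrite !mxE; ring.
rewrite {}aE in h1; rewrite {}bE in h2.
move: h1 h2 vE abE s0 ab za lab z0 zrho.
move: (a - b) => u; move: (z - pi z) => v.
rewrite !dotE (dotC u v); move: (enorm u) (enorm v) => s r.
move=> h1 h2 vE uE; rewrite -{}vE -{}uE in h1 h2; move: (dot v u) h1 h2 => c h1 h2.
move=> s0 ab za lab z0 zrho.
have h3 : r * (2 * rho * r) <= r * (r ^+ 2 + l * (1 - l) * s ^+ 2).
  have l1' : 0 <= 1 - l by lra.
  have g1 := ler_wpM2l l1' h1; have g2 := ler_wpM2l l0 h2.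
  nra.
rewrite ler_pM2l // in h3.
have h4 : r * r <= r * (2 / 27 * rho) by rewrite ler_pM2l //; lra.
have h5 : l * (1 - l) * s ^+ 2 <= l * s * (2 / 27 * rho).
  have : l * s * s <= l * s * (2 / 27 * rho) by rewrite ler_wpM2l ?mulr_ge0 //; lra.
  have : 0 <= l * l * (s * s) by rewrite !mulr_ge0.
  nra.
rewrite -(ler_pM2l rho_gt0); lra.
Qed.

End Reach.

(** * Subdivided segments and triangles as chains of a complex *)

Section Subdivision.
Variables (R : realType) (n : nat) (V : finType) (K : simplicial_complex V).
Variable f : 'rV[R]_n -> V.
Implicit Types x y z : 'rV[R]_n.

Definition midpoint x y := 2^-1 *: (x + y).

Lemma midpointC x y : midpoint x y = midpoint y x.
Proof. by rewrite /midpoint addrC. Qed.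

(** Recursion on midpoints, instead of a list of equally spaced points, matches the subdivision of
    triangles below. *)
Fixpoint seg k x y : chain K 1 :=
  if k is k'.+1 then seg k' x (midpoint x y) + seg k' (midpoint x y) y
  else edge K (f x) (f y).

Lemma segC k x y : seg k x y = seg k y x.
Proof.
elim: k x y => [|k IH] x y /=; first exact: edgeC.
by rewrite midpointC addrC IH (IH (midpoint y x) x).
Qed.

Lemma enorm_midpoint x y z (r : R) : enorm (x - y) <= 2 * r ->
  enorm (midpoint x z - midpoint y z) <= r.
Proof.
have -> : midpoint x z - midpoint y z = 2^-1 *: (x - y).
  by rewrite -scalerBr opprD addrACA subrr addr0.
by rewrite enormZ ger0_norm ?invr_ge0 // ler_pdivrMl.
Qed.

Lemma enorm_midpointl x y (r : R) : enorm (x - y) <= 2 * r ->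
  enorm (x - midpoint x y) <= r.
Proof.
have -> : x - midpoint x y = 2^-1 *: (x - y).
  by apply/rowP => i; rewrite !mxE; field.
by rewrite enormZ ger0_norm ?invr_ge0 // ler_pdivrMl.
Qed.

Variables (B : set 'rV[R]_n) (eta : R).
Hypothesis midpointB : forall x y, B x -> B y -> B (midpoint x y).

(** The midpoints cut a triangle into four of half the size; the inner segments occur twice and
    cancel. *)
Lemma seg_triangle k x y z :
  (forall x y z, B x -> B y -> B z -> enorm (x - y) <= eta ->
     enorm (y - z) <= eta -> enorm (x - z) <= eta -> [set f x; f y; f z]%SET \in K) ->
  B x -> B y -> B z -> enorm (x - y) <= 2 ^+ k * eta ->
  enorm (y - z) <= 2 ^+ k * eta -> enorm (x - z) <= 2 ^+ k * eta ->
  seg k x y + seg k y z + seg k x z \in boundaries K 1.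
Proof.
move=> fine; elim: k x y z => [|k IH] x y z Bx By Bz.
  by rewrite expr0 !mul1r => xy yz xz; apply: triangle_boundaries; exact: fine.
rewrite exprS -!mulrA => xy yz xz /=.
have [yx zy zx] : [/\ enorm (y - x) <= 2 * (2 ^+ k * eta),
    enorm (z - y) <= 2 * (2 ^+ k * eta) & enorm (z - x) <= 2 * (2 ^+ k * eta)].
  by rewrite !(enorm_distC y x, enorm_distC z y, enorm_distC z x).
pose a := midpoint x y; pose b := midpoint y z; pose c := midpoint x z.
have [Ba Bb Bc] : [/\ B a, B b & B c] by split; exact: midpointB.
have ab : enorm (a - b) <= 2 ^+ k * eta.
  by rewrite /a /b (midpointC y z); exact: enorm_midpoint.
have bc : enorm (b - c) <= 2 ^+ k * eta by exact: enorm_midpoint.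
have ac : enorm (a - c) <= 2 ^+ k * eta.
  by rewrite /a /c !(midpointC x); exact: enorm_midpoint.
have xa : enorm (x - a) <= 2 ^+ k * eta by exact: enorm_midpointl.
have xc : enorm (x - c) <= 2 ^+ k * eta by exact: enorm_midpointl.
have yb : enorm (y - b) <= 2 ^+ k * eta by exact: enorm_midpointl.
have ay : enorm (a - y) <= 2 ^+ k * eta.
  by rewrite enorm_distC /a midpointC; exact: enorm_midpointl.
have bz : enorm (b - z) <= 2 ^+ k * eta.
  by rewrite enorm_distC /b midpointC; exact: enorm_midpointl.
have cz : enorm (c - z) <= 2 ^+ k * eta.
  by rewrite enorm_distC /c midpointC; exact: enorm_midpointl.
have t1 := IH x a c Bx Ba Bc xa ac xc.
have t2 := IH a y b Ba By Bb ay yb ab.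
have t3 := IH b c z Bb Bc Bz bc cz bz.
have t4 := IH a b c Ba Bb Bc ab bc ac.
rewrite -/a -/b -/c.
have := memvD (memvD t1 t2) (memvD t3 t4).
set s := (X in X \in _ -> _); set s' := (X in _ -> X \in _).
suff -> : s = s' by [].
rewrite -[RHS]addr0 -(chain_addxx (seg k a b + seg k b c + seg k a c)).
by apply/ffunP => t; rewrite !ffunE; ring.
Qed.

(** A fan of small triangles with apex [p], a vertex that need not be a value of [f]. Its inner
    spokes cancel in pairs. *)
Lemma seg_fan p k x y :
  (forall x y, B x -> B y -> enorm (x - y) <= eta -> [set p; f x; f y]%SET \in K) ->
  B x -> B y -> enorm (x - y) <= 2 ^+ k * eta ->
  seg k x y + (edge K p (f x) + edge K p (f y)) \in boundaries K 1.
Proof.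
move=> fine; elim: k x y => [|k IH] x y Bx By.
  rewrite expr0 mul1r => xy /=; rewrite addrA [X in X + _]addrC.
  by apply: triangle_boundaries; exact: fine.
rewrite exprS -mulrA => xy /=; set m := midpoint x y.
have Bm : B m by exact: midpointB.
have xm : enorm (x - m) <= 2 ^+ k * eta by exact: enorm_midpointl.
have my : enorm (m - y) <= 2 ^+ k * eta.
  by rewrite enorm_distC /m midpointC; apply: enorm_midpointl; rewrite enorm_distC.
have := memvD (IH x m Bx Bm xm) (IH m y Bm By my).
set s := (X in X \in _ -> _); set s' := (X in _ -> X \in _).
suff -> : s = s' by [].
rewrite -[RHS]addr0 -(chain_addxx (edge K p (f m))).
by apply/ffunP => t; rewrite !ffunE; ring.
Qed.

End Subdivision.

(** * Cycles of the Rips complex near a point of [M] are boundaries *)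

Section RipsCycles.
Variables (R : realType) (n : nat) (M : set 'rV[R]_n).
Variables (pi : 'rV[R]_n -> 'rV[R]_n) (rho alpha eps : R) (P : {fset 'rV[R]_n}).
Hypothesis compactM : compact M.
Hypothesis piP : forall z, nearest_points M z (pi z).
Hypothesis nearest_unique : forall z x,
  nearest_points M z x -> enorm (z - pi z) < rho -> x = pi z.
Hypothesis rho_gt0 : 0 < rho.
Hypothesis PM : [set` P] `<=` M.
Hypothesis sampleP : forall x, M x -> exists p : P, enorm (x - val p) <= eps.
Hypothesis eps_alpha : 12 * eps <= alpha.
Hypothesis alpha_rho : 27 * alpha <= 2 * rho.
Hypothesis alpha_gt0 : 0 < alpha.

Local Notation d z := (enorm (z - pi z)).
Local Notation K := (rips alpha P).

Lemma val_in (p : P) : M (val p).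
Proof. exact/PM/valP. Qed.

Lemma rips_edgeP (p q : P) : [set p; q]%SET \in K -> enorm (val p - val q) <= alpha.
Proof.
rewrite inE => /andP[_ /is_cliqueP pq].
have [->|npq] := eqVneq p q; first by rewrite subrr enorm0 ltW.
by rewrite -eucl_distE pq ?set21 ?set22.
Qed.

Lemma rips_edge (p q : P) : enorm (val p - val q) <= alpha -> [set p; q]%SET \in K.
Proof.
move=> pq; rewrite inE; apply/andP; split; first by apply/set0Pn; exists p; rewrite set21.
apply/is_cliqueP => a b; rewrite !inE => /orP[] /eqP -> /orP[] /eqP ->;
  by rewrite ?eqxx // eucl_distE // enorm_distC.
Qed.

Lemma rips_triangle (p q r : P) : enorm (val p - val q) <= alpha ->
  enorm (val q - val r) <= alpha -> enorm (val p - val r) <= alpha ->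
  [set p; q; r]%SET \in K.
Proof.
move=> pq qr pr; rewrite inE; apply/andP; split.
  by apply/set0Pn; exists p; rewrite !inE eqxx.
apply/is_cliqueP => a b; rewrite !inE -!orbA => /or3P[] /eqP -> /or3P[] /eqP ->;
  by rewrite ?eqxx // eucl_distE // enorm_distC.
Qed.

Variable f : 'rV[R]_n -> P.
Hypothesis fP : forall x, enorm (pi x - val (f x)) <= eps.

(** The mesh of the subdivisions: [pi] at most doubles distances and [f] adds [eps] at each end, so
    points [eta] apart have images at most [2 * eta + 2 * eps <= alpha] apart. *)
Let eta := 5 / 12 * alpha.

Lemma sample_fine x y : 2 * d x <= rho -> 2 * d y <= rho -> enorm (x - y) <= eta ->
  enorm (val (f x) - val (f y)) <= alpha.
Proof.
move=> dx dy xy.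
have h1 := pi_lipschitz compactM piP nearest_unique rho_gt0 dx dy.
have h2 := enorm_dist_triangle (pi x) (val (f x)) (val (f y)).
have h3 := enorm_dist_triangle (pi y) (pi x) (val (f y)).
have h4 := fP x; have h5 := fP y.
rewrite (enorm_distC _ (pi x)) in h2.
move: eps_alpha; rewrite /eta in xy; lra.
Qed.

Lemma exp2_large (D : R) : exists k, D <= 2 ^+ k * eta.
Proof.
have eta0 : 0 < eta by rewrite mulr_gt0 // divr_gt0.
exists (Num.truncn (D / eta)).+1; rewrite -ler_pdivrMr //.
apply: le_trans (ltW (truncnS_gt _)) _.
by rewrite -natrX ler_nat ltnW // ltn_expl.
Qed.

(** Points of the half next to [p] are within [alpha / 2] of [p] and [alpha / 52] of [M], and
    [eps <= alpha / 12]; hence their samples are within [alpha] of [p] and the fan at [p] lies in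
    the Rips complex. Over the whole segment its spokes could be too long. *)
Lemma seg_half_edge (p q : P) k : enorm (val p - val q) <= alpha ->
  alpha <= 2 ^+ k * eta ->
  seg K f k (val p) (midpoint (val p) (val q)) +
    (edge K p (f (val p)) + edge K p (f (midpoint (val p) (val q))))
  \in boundaries K 1 /\
  enorm (val p - val (f (midpoint (val p) (val q)))) <= alpha.
Proof.
move=> pq ka; set a := val p; set b := val q.
pose B : set 'rV[R]_n := [set x | exists2 l, 0 <= l <= 2^-1 & x = convex_comb l a b].
have Ba : B a.
  by exists 0; rewrite ?lexx ?invr_ge0 //= /convex_comb subr0 scale1r scale0r addr0.
have Bm : B (midpoint a b).
  exists 2^-1; first by rewrite lexx invr_ge0 ler0n.
  by apply/rowP => i; rewrite !mxE; field.
have dB x : B x -> 26 * d x <= 2^-1 * enorm (a - b) /\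
    enorm (a - x) <= 2^-1 * enorm (a - b).
  case=> l /andP[l0 l1] ->; split.
    apply: le_trans (dist_chord compactM piP nearest_unique rho_gt0 _ _ _ _) _.
    1,2: exact: val_in.
    - by rewrite l0; move: l1; lra.
    - by move: alpha_rho pq; rewrite -/a -/b; lra.
    - by rewrite ler_wpM2r ?enorm_ge0.
  have -> : a - convex_comb l a b = l *: (a - b).
    by apply/rowP => i; rewrite !mxE; ring.
  by rewrite enormZ ger0_norm // ler_wpM2r ?enorm_ge0.
rewrite -/a -/b in pq.
have dB2 x : B x -> 2 * d x <= rho.
  by case/dB => + _; move: pq alpha_rho rho_gt0; have := enorm_ge0 (a - b); lra.
have pf x : B x -> enorm (a - val (f x)) <= alpha.
  case/dB => h1 h2; have h3 := enorm_dist_triangle x a (val (f x)).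
  have h4 := enorm_dist_triangle (pi x) x (val (f x)).
  by have := fP x; move: pq eps_alpha alpha_gt0; lra.
split; last exact: pf.
apply: (seg_fan (B := B) (eta := eta)) => //.
- move=> x y [l /andP[l0 l1] ->] [l' /andP[l'0 l'1] ->].
  exists (2^-1 * (l + l')); first by apply/andP; split; lra.
  by apply/rowP => i; rewrite !mxE; field.
- move=> x y Bx By xy; apply: rips_triangle; [exact: pf| |exact: pf].
  by apply: sample_fine => //; exact: dB2.
- apply: le_trans ka; have [_] := dB _ Bm.
  by have := enorm_ge0 (a - b); move: pq; lra.
Qed.

(** The loop is filled by the fans at [p] and [q] over the two halves and the triangle of [p], [q]
    and the sample at the midpoint. *)
Lemma seg_edge (p q : P) k : enorm (val p - val q) <= alpha ->
  alpha <= 2 ^+ k * eta ->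
  edge K p q + seg K f k.+1 (val p) (val q) +
    (edge K p (f (val p)) + edge K q (f (val q))) \in boundaries K 1.
Proof.
move=> pq ka; have qp := pq; rewrite enorm_distC in qp.
have [h1 pm] := seg_half_edge pq ka; have [h2 qm] := seg_half_edge qp ka.
rewrite (midpointC (val q)) in h2 qm; rewrite segC in h2; rewrite /=.
set m := midpoint _ _ in h1 h2 pm qm *.
have h3 : edge K p q + edge K q (f m) + edge K p (f m) \in boundaries K 1.
  by apply: triangle_boundaries; exact: rips_triangle.
have := memvD (memvD h1 h2) h3.
set s := (X in X \in _ -> _); set s' := (X in _ -> X \in _).
suff -> : s = s' by [].
rewrite -[RHS]addr0 -(chain_addxx (edge K p (f m) + edge K q (f m))).
by apply/ffunP => t; rewrite !ffunE; ring.
Qed.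

(** Coning from [c]: [seg_edge] fills the strip between an edge and the image of its segment, and
    [seg_triangle] fills the image of the triangle with apex [c]. The ball of radius [r] is convex
    and its points are within [rho / 2] of [M], so [pi] is 2-Lipschitz on it. *)
Lemma local_cycle_boundaries c r (A : {set P}) (z : chain K 1) :
  M c -> 2 * r <= rho -> (forall p, p \in A -> enorm (val p - c) <= r) ->
  boundary z = 0 -> supported A z -> z \in boundaries K 1.
Proof.
move=> Mc rrho Ar z0 zA.
(* This bounds all sides, edges being at most [alpha] long and radii at most [r]. The paths use
   [k0.+1] because [seg_edge] works on halves. *)
have [k0 k0P] := exp2_large (alpha + 2 * r).
pose B : set 'rV[R]_n := [set x | enorm (x - c) <= r].
apply: (cycle_boundaries (g := fun a => edge K a (f (val a)) + seg K f k0.+1 c (val a))) => //.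
move=> t a b zt ab tE abK.
have := zA t zt; rewrite tE => /fintype.subsetP abA.
have Ba : B (val a) by apply/Ar/abA; rewrite set21.
have Bb : B (val b) by apply/Ar/abA; rewrite set22.
have r0 : 0 <= r by apply: le_trans Ba; exact: enorm_ge0.
have Bc : B c by rewrite /B /= subrr enorm0.
have pq := rips_edgeP abK.
have h1 : edge K a b + seg K f k0.+1 (val a) (val b) +
    (edge K a (f (val a)) + edge K b (f (val b))) \in boundaries K 1.
  by apply: seg_edge => //; apply: le_trans k0P; rewrite lerDl mulr_ge0.
have eta0 : 0 < eta by rewrite mulr_gt0 // divr_gt0.
have dB x : B x -> 2 * d x <= rho.
  by move=> Bx; have := pi_le piP x Mc; rewrite /B /= in Bx; lra.
have k0P' D : D <= alpha + 2 * r -> D <= 2 ^+ k0.+1 * eta.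
  move=> h; apply: le_trans h (le_trans k0P _).
  by rewrite ler_pM2r // exprS ler_peMl ?exprn_ge0 // ler1n.
have h2 : seg K f k0.+1 c (val a) + seg K f k0.+1 (val a) (val b) +
    seg K f k0.+1 c (val b) \in boundaries K 1.
  apply: (seg_triangle (B := B) (eta := eta)) => //.
  - move=> x y Bx By.
    have -> : midpoint x y = convex_comb 2^-1 x y.
      by apply/rowP => i; rewrite !mxE; field.
    apply: enorm_convex_comb => //; rewrite invr_ge0 ler0n /=.
    by rewrite invf_le1 // ler1n.
  - move=> x y w Bx By Bw xy yw xw; apply: rips_triangle; apply: sample_fine => //; exact: dB.
  - by apply: k0P'; rewrite enorm_distC; rewrite /B /= in Ba; move: alpha_gt0; lra.
  - by apply: k0P'; move: alpha_gt0; lra.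
  - by apply: k0P'; rewrite enorm_distC; rewrite /B /= in Bb; move: alpha_gt0; lra.
have := memvD h1 h2.
set s := (X in X \in _ -> _); set s' := (X in _ -> X \in _).
suff -> : s = s' by [].
rewrite -[RHS]addr0 -(chain_addxx (seg K f k0.+1 (val a) (val b))).
by apply/ffunP => u; rewrite !ffunE; ring.
Qed.

End RipsCycles.

(** * Paths inside Voronoi cells, and the homology of the nearest point map *)

Section NearestPointMap.
Variables (R : realType) (n : nat) (M : set 'rV[R]_n).
Variables (pi : 'rV[R]_n -> 'rV[R]_n) (rho alpha delta eps : R).
Variables (P Q : {fset 'rV[R]_n}) (nu : P -> Q).
Hypothesis compactM : compact M.
Hypothesis piP : forall z, nearest_points M z (pi z).
Hypothesis nearest_unique : forall z x,
  nearest_points M z x -> enorm (z - pi z) < rho -> x = pi z.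
Hypothesis rho_gt0 : 0 < rho.
Hypothesis PM : [set` P] `<=` M.
Hypothesis QP : [set` Q] `<=` [set` P].
Hypothesis sampleP : forall x, M x -> exists p : P, enorm (x - val p) <= eps.
Hypothesis sampleQ : forall p : P, exists q : Q, enorm (val p - val q) <= delta.
Hypothesis sparseQ : is_sparse (@eucl_dist R n) Q delta.
Hypothesis nuP : nearest_point_map (@eucl_dist R n) nu.
Hypothesis eps_alpha : 12 * eps <= alpha.
Hypothesis alpha_rho : 27 * alpha <= 2 * rho.
Hypothesis delta_rho : 27 * delta <= 2 * rho.
Hypothesis alpha_gt0 : 0 < alpha.

Local Notation d z := (enorm (z - pi z)).
Local Notation K := (rips alpha P).
Local Notation h := (gic_map alpha nu).

Lemma nu_le (p : P) (q : Q) : enorm (val p - val (nu p)) <= enorm (val p - val q).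
Proof. by rewrite -!eucl_distE; exact: nuP. Qed.

Lemma nu_le_delta (p : P) : enorm (val p - val (nu p)) <= delta.
Proof. by have [q] := sampleQ p; exact: le_trans (nu_le p q). Qed.

(* A sample point near the point of [p, nu p] at distance alpha / 4 from p is
   closer to nu p than p is, and stays in the same Voronoi cell: the difference
   of the squared distances to another point of Q and to nu p is affine, >= 0
   at p, and at least delta ^ 2 at nu p. *)
Lemma nu_descent (p : P) : alpha < enorm (val p - val (nu p)) ->
  exists p' : P, [/\ enorm (val p - val p') <= alpha, nu p' = nu p &
    enorm (val p' - val (nu p)) < enorm (val p - val (nu p))].
Proof.
set q := nu p; set s := enorm _ => alpha_s.
have s0 : 0 < s by exact: lt_trans alpha_s.
pose l := alpha / (4 * s); have ls : l * s = alpha / 4.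
  by rewrite /l; field; rewrite gt_eqF.
have l0 : 0 < l by rewrite divr_gt0 ?mulr_gt0.
have l1 : l <= 1.
  by rewrite ler_pdivrMr ?mulr_gt0 // mul1r; move: alpha_s s0; lra.
pose z := convex_comb l (val p) (val q).
have Mp : M (val p) by exact/PM/valP.
have Mq : M (val q) by exact/PM/QP/valP.
have dz : 26 * d z <= alpha / 4.
  rewrite -ls; apply: (dist_chord compactM piP nearest_unique rho_gt0 Mp Mq).
    by rewrite (ltW l0).
  by have := nu_le_delta p; rewrite -/q -/s; move: delta_rho; lra.
have [p' p'z] := sampleP (pi_in piP z).
(* The two terms bound the distance from [z] to [M] and [eps]. *)
have {}p'z : enorm (val p' - z) <= alpha / 104 + alpha / 12.
  have := enorm_dist_triangle (pi z) z (val p').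
  by rewrite (enorm_distC (val p')); move: p'z dz eps_alpha; lra.
have pz : enorm (val p - z) = alpha / 4.
  rewrite -ls; have -> : val p - z = l *: (val p - val q).
    by apply/rowP => i; rewrite !mxE; ring.
  by rewrite enormZ gtr0_norm.
have zqE : z - val q = (1 - l) *: (val p - val q).
  by apply/rowP => i; rewrite !mxE; ring.
have zq : enorm (z - val q) = s - alpha / 4.
  by rewrite zqE enormZ ger0_norm ?subr_ge0 // -/s -ls; ring.
exists p'; split.
- have := enorm_dist_triangle z (val p) (val p').
  by rewrite (enorm_distC z); move: alpha_gt0; lra.
- apply/eqP/negPn/negP => nq.
  have /= := nu_le p' q; rewrite -/s; set q' := nu p' in nq * => p'q.
  have ds : s <= enorm (val q - val q').
    apply: le_trans (nu_le_delta p) _; rewrite -eucl_distE.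
    by apply: sparseQ; [exact: valP|exact: valP|]; apply: contraNneq nq => /val_inj ->.
  have F1 : 0 <= 2 * dot (val p - val q) (val q - val q') +
                 dot (val q - val q') (val q - val q').
    have : enorm (val p - val q) ^+ 2 <= enorm (val p - val q') ^+ 2.
      by rewrite ler_sqr ?nnegrE ?enorm_ge0 //; exact: nu_le.
    have -> : val p - val q' = (val p - val q) + (val q - val q').
      by rewrite addrA subrK.
    rewrite !enorm_sqr; move: (val p - val q) (val q - val q') => a b.
    by rewrite !dotE (dotC b); lra.
  have F2 : 2 * dot (val p' - val q) (val q - val q') +
                 dot (val q - val q') (val q - val q') <= 0.
    have : enorm (val p' - val q') ^+ 2 <= enorm (val p' - val q) ^+ 2.
      by rewrite ler_sqr ?nnegrE ?enorm_ge0.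
    have -> : val p' - val q' = (val p' - val q) + (val q - val q').
      by rewrite addrA subrK.
    rewrite !enorm_sqr; move: (val p' - val q) (val q - val q') => a b.
    by rewrite !dotE (dotC b); lra.
  have p'qE : val p' - val q = (val p' - z) + (1 - l) *: (val p - val q).
    by rewrite -zqE addrA subrK.
  rewrite {}p'qE in F2.
  have CS := dot_le_enorm (z - val p') (val q - val q').
  have zN : z - val p' = - (val p' - z) by rewrite opprB.
  have bE := enorm_sqr (val q - val q').
  rewrite zN enormN dotNl in CS; rewrite dotDl dotZl in F2.
  rewrite -{}bE in F1 F2.
  move: (enorm (val q - val q')) ds CS F1 F2 => D ds CS F1 F2.
  have D0 : 0 < D by exact: lt_le_trans ds.
  have h1 : enorm (val p' - z) * D <= (alpha / 104 + alpha / 12) * D.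
    by rewrite ler_pM2r.
  have h2 : 0 <= (1 - l) * (2 * dot (val p - val q) (val q - val q') + D ^+ 2).
    by apply: mulr_ge0; rewrite ?subr_ge0.
  (* The gain [l * D * D] is at least [alpha / 4 * D]. Replacing [z] by [p'] costs at most
     [2 * (alpha / 104 + alpha / 12) * D], which is less because [1 / 52 + 1 / 6 < 1 / 4]. *)
  have h3 : l * D * s <= l * D * D.
    by apply: ler_wpM2l ds; exact: mulr_ge0 (ltW l0) (ltW D0).
  have h4 : l * D * s = alpha / 4 * D by rewrite -ls; ring.
  have h5 : 0 < alpha * D by rewrite mulr_gt0.
  move: (dot (val p - val q) _) (dot (val p' - z) _) CS F1 F2 h2 => A C CS F1 F2 h2.
  by rewrite h4 in h3; lra.
- have := enorm_dist_triangle z (val p') (val q).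
  by move: alpha_gt0; lra.
Qed.

Variable iota : Q -> P.
Hypothesis val_iota : forall q, val (iota q) = val q.

Lemma nu_iota q : nu (iota q) = q.
Proof.
apply/val_inj; have := nu_le (iota q) q; rewrite val_iota subrr enorm0 => h.
have /eqP : enorm (val q - val (nu (iota q))) = 0.
  by apply/eqP; rewrite eq_le h enorm_ge0.
by move/eqP/enorm_eq0/eqP; rewrite subr_eq0 => /eqP.
Qed.

(** [nu_descent] is repeated until one edge reaches [nu p]. It terminates because the number of
    sample points closer to [nu p] than the current point decreases. *)
Lemma nu_path (p : P) : exists g : chain K 1,
  boundary g = vtx K p + vtx K (iota (nu p)) /\
  supported (nu @^-1: [set nu p]%SET) g.
Proof.
have edge_cell (a b : P) : nu b = nu a -> 
    supported (nu @^-1: [set nu a]%SET) (edge K a b).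
  move=> ab; apply: supported_schain; apply/fintype.subsetP => x.
  by rewrite !inE => /orP[] /eqP -> //; rewrite ab.
have [m] := ubnP
  #|[set x : P | enorm (val x - val (nu p)) < enorm (val p - val (nu p))]%SET|.
elim: m p => // m IH p; rewrite ltnS => pm.
have [near|/nu_descent[p' [pp' nup' closer]]] := lerP (enorm (val p - val (nu p))) alpha.
  exists (edge K p (iota (nu p))); split; last by apply: edge_cell; rewrite nu_iota.
  by rewrite boundary_edge //; apply: rips_edge => //; rewrite val_iota.
have [|g [gB gS]] := IH p'.
  apply: leq_trans pm; apply: proper_card; apply/fintype.properP; split.
    apply/fintype.subsetP => x; rewrite !inE nup' => /lt_trans; exact.
  by exists p'; rewrite !inE ?nup' ?ltxx.
exists (edge K p p' + g); split.
  rewrite linearD /= gB nup' boundary_edge; last exact: rips_edge.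
  by rewrite -addrA chain_addKK.
by apply: supportedD; [exact: edge_cell|rewrite -nup'].
Qed.

Lemma gic_lift (t : {set Q}) : t \in gic alpha nu ->
  exists s : {set P}, [/\ s \in K, #|s| = #|t| & h @: s = t].
Proof.
rewrite inE => /andP[t0 /existsP[s /and3P[sC /eqP st /eqP sE]]].
exists s; split => //; rewrite inE sC andbT -card_gt0 st card_gt0 //.
Qed.

Lemma gic_map_bijective : bijective (@homology_map _ _ _ _ h 1).
Proof.
have [G GP] := choice nu_path.
have liftP (t : {set Q}) : exists s : {set P}, t \in gic alpha nu ->
    [/\ s \in K, #|s| = #|t| & h @: s = t].
  have [/gic_lift[s ?]|tL] := boolP (t \in gic alpha nu); first by exists s.
  (* An arbitrary value: only lifts of simplices matter. *)
  by exists finset.set0.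
have [lift {}liftP] := choice liftP.
have GB v : [set v]%SET \in K -> boundary (G v) = vtx K v + vtx K (iota (h v)).
  by case: (GP v).
have GS v : supported (h @^-1: [set h v]%SET) (G v) by case: (GP v).
apply: homology_map_bijective; last exact: chain_map_surj liftP GB GS.
apply: chain_map_inj liftP GB GS _ => a b c abK c0 cA.
have samplef x : exists p : P, enorm (pi x - val p) <= eps.
  by exact: (sampleP (pi_in piP x)).
have [f fP] := choice samplef.
(* Points of the two cells are within [delta] of their centers, and both centers are within
   [alpha + delta] of [a]. The radius is at most [6 / 27 * rho], below [rho / 2]. *)
apply: (local_cycle_boundaries compactM piP nearest_unique rho_gt0 PM eps_alpha
  alpha_rho alpha_gt0 fP (c := val a) (r := alpha + 2 * delta) _ _ _ c0 cA).
- exact/PM/valP.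
- by move: alpha_rho delta_rho rho_gt0; lra.
move=> p; rewrite !inE => pA.
have ab := rips_edgeP alpha_gt0 abK.
have := nu_le_delta p; case/orP: pA => /eqP /= ->.
  have := enorm_dist_triangle (val (nu a)) (val p) (val a).
  have := nu_le_delta a; rewrite (enorm_distC (val (nu a))).
  by move: alpha_gt0; lra.
have := enorm_dist_triangle (val (nu b)) (val p) (val a).
have := enorm_dist_triangle (val b) (val (nu b)) (val a).
have := nu_le_delta b; rewrite (enorm_distC (val (nu b)) (val b)).
by move: ab; rewrite (enorm_distC (val a)); lra.
Qed.

End NearestPointMap.

(** * Complexes without edges, and the choice of a finite [rho] *)

Theorem theorem3p5 (R : realType) (M : set 'rV[R]_3) (eps delta alpha : R)
    (P Q : {fset 'rV[R]_3}) (nu : P -> Q) :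
  smooth_submanifold 2 M -> compact M -> (0 < reach M)%E ->
  is_sample (@eucl_dist R 3) M P eps ->
  is_sample (@eucl_dist R 3) [set` P] Q delta ->
  is_sparse (@eucl_dist R 3) Q delta ->
  nearest_point_map (@eucl_dist R 3) nu ->
  12 * eps <= alpha -> (alpha%:E <= (2 / 27)%:E * reach M)%E ->
  8 * eps <= delta -> (delta%:E <= (2 / 27)%:E * reach M)%E ->
  bijective (@homology_map _ _ _ _ (gic_map alpha nu) 1).
Proof.
move=> _ cM reach0 [PM sampleP] [QP sampleQ] sparseQ nuP eps_alpha alpha_reach.
move=> _ delta_reach.
(* Without an edge both spaces of 1-chains are 0; this covers [alpha <= 0] and an empty [M]. An edge
   forces [alpha] to be positive and [M] to have a point. *)
have [[t _]|no_edge] := pselect (exists t : ksimplex (rips alpha P) 1, True);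
    last first.
  have lift0 : ksimplex (gic alpha nu) 1 -> False.
    move=> t; have /andP[tL /eqP tk] := valP t.
    have [s [sK sk _]] := gic_lift tL; apply: no_edge.
    have sP : (s \in rips alpha P) && (#|s| == 2) by rewrite sK sk tk.
    by exists (exist _ s sP).
  apply: homology_map_bijective => [z _ _|w w0].
    have -> : z = 0 by apply/ffunP => t; case: no_edge; exists t.
    exact: mem0v.
  exists 0; first exact: linear0.
  by apply/ffunP => t; case: (lift0 t).
have [a [b [ab _ abK]]] := ksimplex1P t.
have alpha0 : 0 < alpha.
  move: abK; rewrite inE => /andP[_ /is_cliqueP/(_ a b)].
  rewrite set21 set22 ab => /(_ isT isT isT); apply: lt_le_trans.
  rewrite eucl_distE lt_neqAle enorm_ge0 andbT eq_sym; apply: contra ab => /eqP.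
  by move=> /enorm_eq0/eqP; rewrite subr_eq0 => /eqP /val_inj ->.
have M0 : M !=set0 by exists (val a); exact/PM/valP.
have [rho [rho0 rhoM alpha_rho delta_rho]] : exists rho, [/\ 0 < rho,
    (rho%:E <= reach M)%E, 27 * alpha <= 2 * rho & 27 * delta <= 2 * rho].
  move: reach0 alpha_reach delta_reach; case: (reach M) => [r| |] //.
    rewrite lte_fin -EFinM !lee_fin => r0 h1 h2.
    by exists r; split => //; lra.
  (* For an infinite reach, any positive [rho] that meets the bounds on [alpha] and [delta] will
     do. *)
  move=> _ _ _; exists (27 / 2 * Num.max alpha delta); split.
  - by rewrite mulr_gt0 ?divr_gt0 // lt_max alpha0.
  - exact: leey.
  - have : alpha <= Num.max alpha delta by rewrite le_max lexx.
    lra.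
  - have : delta <= Num.max alpha delta by rewrite le_max lexx orbT.
    lra.
have [pi piP] := choice (fun z => nearest_point_exists z cM M0).
have iotaP (q : Q) : exists p : P, val p = val q.
  by have qP : val q \in P := QP _ (valP q); exists [` qP]%fset.
have [iota val_iota] := choice iotaP.
apply: (gic_map_bijective (M := M) (pi := pi) (rho := rho) (delta := delta) (eps := eps)
  _ _ _ _ _ _ _ _ _ _ _ _ _ _ val_iota) => //.
- move=> z x zx zrho; apply/esym; apply: reach_nearest_unique rhoM (piP z) zx _.
  by rewrite eucl_distE.
- move=> x /sampleP[p pP xp]; exists [` pP]%fset.
  by rewrite -eucl_distE.
- move=> p; have [q qQ pq] := sampleQ (val p) (valP p); exists [` qQ]%fset.
  by rewrite -eucl_distE.
Qed.
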